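(* There exists a function $K_0:\mathbb{Z}_{\geq 1}\to\mathbb{Z}_{\geq 1}$ with $K_0(l)=O(l^4)$ such that the following holds. Let $B$ (blue points) and $R$ (red points) be disjoint finite sets in the plane such that $B\cup R$ is in general position (no three points collinear), $|R|=l\geq 1$, and the vertices of the convex hull of $B\cup R$ are $n$ blue points. Let $k=|B|-n$ be the number of blue points in the interior of $\mathrm{Conv}(B)$. If $k\geq K_0(l)$, then there exists a simple polygon whose vertex set is exactly $B$ and which excludes $R$ (every red point lies in the exterior of the polygon).
   Context: $\mathrm{Conv}(X)$ denotes the convex hull of $X$. A polygonization of a finite point set $S$ is a simple (closed, non-self-intersecting) polygon whose vertex set is exactly $S$. A polygon excludes a point set $V$ if all points of $V$ lie in the exterior of the polygon. *)

(* Defs.v *)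
From HB Require Import structures.
From mathcomp Require Import all_boot all_order all_algebra finmap.
From mathcomp Require Import all_classical all_reals all_analysis.
Export numFieldNormedType.Exports.
Set Implicit Arguments.
Unset Strict Implicit.
Unset Printing Implicit Defensive.
Import Order.TTheory GRing.Theory Num.Theory.
Local Open Scope classical_set_scope.
Local Open Scope ring_scope.
Local Open Scope convex_scope.

Notation plane R := (R * R)%type.

Section Plane.
Context {R : realType}.
Implicit Types (S V : {fset plane R}) (X : set (plane R)) (p q : plane R).

Definition collinear X : Prop :=
  exists a b c : R, (a, b) != (0, 0) /\ X `<=` [set p | a * p.1 + b * p.2 = c].

Definition general_position S : Prop :=
  forall p q r, p \in S -> q \in S -> r \in S -> uniq [:: p; q; r] ->
    ~ collinear [set p; q; r].

Definition convex_hull X : set (plane R) := smallest (@convex_set R (plane R)) X.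

(* For X the convex hull of a finite set, a convex polygon, these are its
   vertices. *)
Definition extreme_points X : set (plane R) :=
  [set v | X v /\ forall (p q : convex_lmodType (plane R)) (t : {i01 R}),
     X p -> X q -> 0 < t%:num < 1 -> v = p <| t |> q -> p = q].

Definition segment p q : set (plane R) :=
  range (fun t : {i01 R} => (p : convex_lmodType (plane R)) <| t |> q).

(* A polygon is given by the cyclic sequence s of its vertices: its edges are
   the segments from v to next s v, for v in s. *)
Definition polygon_boundary (s : seq (plane R)) : set (plane R) :=
  \bigcup_(v in [set` s]) segment v (next s v).

Definition simple_polygon (s : seq (plane R)) : Prop :=
  [/\ (3 <= size s)%N, uniq s &
      forall v w, v \in s -> w \in s -> v != w ->
        segment v (next s v) `&` segment w (next s w) `<=`
        [set v; next s v] `&` [set w; next s w]].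

Definition polygonization (s : seq (plane R)) S : Prop :=
  simple_polygon s /\ s =i S.

(* The union of the unbounded connected components of the complement of the
   boundary. *)
Definition exterior (s : seq (plane R)) : set (plane R) :=
  [set p | ~ polygon_boundary s p /\
     ~ bounded_set (connected_component (~` polygon_boundary s) p)].

Definition excludes (s : seq (plane R)) V : Prop := [set` V] `<=` exterior s.

End Plane.

(* Main.v *)
Require Import Defs.
From mathcomp Require Import all_boot all_order all_algebra finmap.
From mathcomp Require Import all_classical all_reals all_analysis.
From mathcomp Require Import ring lra zify.
Set Implicit Arguments.
Unset Strict Implicit.
Unset Printing Implicit Defensive.
Import Order.TTheory GRing.Theory Num.Theory.
Local Open Scope ring_scope.

(* Let P be blue points and Rd at most (|P| + 2) / 3 red points such that every p in P sees every r in Rd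
   to one fixed side of each of two points a and b. Then a and b are joined by a simple path through any
   prescribed blue set containing P so that every red point escapes to infinity close to the path: cut
   by a suitable line through a point of P and recurse on both sides (Lemma escaping_path).

   Let v be a hull vertex, and order all points by angle around v. By pigeonhole many interior blue
   points see no red point between them from v. Compare them with the hull vertices in this order. If
   many of them lie between the same two consecutive hull vertices A and B, they lie in the triangle A B v;
   after two more pigeonholes the red points do not separate them as seen from A or B either. Cevians through
   a suitable interior point then split the plane into three sectors with enough of them in each, and the
   polygon is made of three paths A -> B -> v -> A. Otherwise many of them have hull vertices z1 below
   and z2 above, still with no red point in between; the polygon follows the hull from z1 to z2 and
   returns by two paths z2 -> v and v -> z1, which are separated by the line from v to the median point. *)

(** * Orientation, segments and edge sequences *)

Lemma cut_balanced (T : Type) (red : pred T) (l : seq T) :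
  (0 < count red l)%N -> (3 * count red l <= count (predC red) l + 3)%N ->
  exists l1 x l2, [/\ l = l1 ++ x :: l2,
    (3 * count red l1 <= count (predC red) l2 + 2)%N,
    (3 * count red l2 <= count (predC red) l1 + 2)%N &
    red x || (0 < count red l1)%N && (0 < count red l2)%N].
Proof.
move=> t0 tm.
have [k1 [z [k2 [El rz k20]]]] : exists l1 x l2, [/\ l = l1 ++ x :: l2, red x &
    count red l2 = 0%N].
  elim: l t0 {tm} => //= c l IH; have [l0|l0] := posnP (count red l).
    by rewrite l0 addn0 lt0b => rc; exists [::], c, l.
  move=> _; have [l1 [x [l2 [-> rx l2r]]]] := IH l0.
  by exists (c :: l1), x, l2.
have t1 : count red l = (count red k1).+1.
  by rewrite El count_cat /= rz k20 addn0 addn1.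
(* Cutting at the last red entry is tried first. Its failure excludes, at the end, the case of a
   non-red [x] behind all red entries. *)
have [ok|nok] := leqP (3 * count red k1) (count (predC red) k2 + 2).
  by exists k1, z, k2; split=> //; rewrite ?k20 ?muln0 // rz.
pose ok i := (i < size l)%N &&
  (3 * count red (take i l) <= count (predC red) (drop i.+1 l) + 2)%N.
have ok0 : exists i, ok i.
  exists 0%N; rewrite /ok take0 /= muln0 andbT.
  by case: (l) t0.
have okb i : ok i -> (i <= size l)%N by case/andP => /ltnW.
case: (ex_maxnP ok0 okb) => i /andP[il oki] maxi.
have x0 : T by case: (l) t0.
have Ed : l = take i l ++ nth x0 l i :: drop i.+1 l.
  by rewrite -drop_nth // cat_take_drop.
move: oki; set l1 := take i l in Ed *; set l2 := drop i.+1 l in Ed *.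
set x := nth x0 l i in Ed * => oki.
have cR : count red l = (count red l1 + (red x + count red l2))%N.
  by rewrite {1}Ed count_cat.
have cP : count (predC red) l = (count (predC red) l1 + (~~ red x + count (predC red) l2))%N.
  by rewrite {1}Ed count_cat.
have szk : (i.+1 < size l)%N -> exists w l3, l2 = w :: l3 /\
   (count (predC red) l3 + 2 < 3 * (count red l1 + red x))%N.
  move=> il2; exists (nth x0 l i.+1), (drop i.+2 l); split; first exact: drop_nth.
  rewrite ltnNge; apply/negP => H.
  have : ok i.+1.
    rewrite /ok il2 (take_nth x0) // -cats1 count_cat /= addn0.
    exact: H.
  by move/maxi; rewrite ltnn.
have [il2|il2] := ltnP i.+1 (size l); last first.
  have l20 : l2 = [::] by apply: drop_oversize.
  exists l1, x, l2; split=> //; rewrite ?l20 //.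
  move: oki t0; rewrite cR l20 /=; case: (red x) => //=.
  by clear; lia.
have [w [l3 [El2 bd]]] := szk il2.
have cP2 : (count (predC red) l2 <= (count (predC red) l3).+1)%N.
  by rewrite El2 /=; case: (red w).
case rx : (red x); rewrite rx /= in cR cP bd.
  exists l1, x, l2; rewrite rx; split=> //.
  by move: cR cP cP2 bd oki tm; clear; lia.
have [l2r|l2r] := posnP (count red l2); last first.
  exists l1, x, l2; rewrite rx l2r /= andbT; split=> //.
    by move: cR cP cP2 bd oki tm; clear; lia.
  by move: oki bd cP2; clear; lia.
exfalso.
(* all reds lie before index i, so the points after the last red include those after i *)
have : (count (predC red) l2 <= count (predC red) k2)%N; last first.
  by move: cR cP cP2 bd oki tm nok t1 l2r; clear; lia.
have szE : (size l1 + (size l2).+1 = size k1 + (size k2).+1)%N.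
  by rewrite -[(size l2).+1]/(size (x :: l2)) -[(size k2).+1]/(size (z :: k2)) -!size_cat -Ed -El.
have sk : (size l2 <= size k2)%N.
  rewrite leqNgt; apply/negP => sk.
  have : count red l2 = count red (drop (size l - size l2) l).
    by rewrite [in RHS]Ed -cat_rcons size_cat addnK size_rcons -(size_rcons l1 x) drop_size_cat.
  have -> : (size l - size l2 = size k1 - (size l2 - (size k2).+1))%N.
    have -> : size l = (size k1 + (size k2).+1)%N by rewrite El size_cat.
    by move: sk; clear; lia.
  rewrite l2r El.
  set j := (_ - (_ - _))%N; have jk : (j <= size k1)%N by rewrite /j leq_subr.
  have -> : drop j (k1 ++ z :: k2) = drop j k1 ++ z :: k2.
    by rewrite drop_cat; case: ltngtP jk => // -> _; rewrite subnn drop0 drop_size.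
  by rewrite count_cat /= rz; lia.
have -> : l2 = drop (size k2 - size l2) k2.
  have : drop (size k1).+1 l = k2 by rewrite El -cat_rcons drop_size_cat // size_rcons.
  move=> <-; rewrite drop_drop size_drop.
  have -> : (size l - (size k1).+1 = size k2)%N by rewrite El size_cat /=; lia.
  have l1i : size l1 = i by rewrite /l1 size_take il.
  rewrite {1}/l2; congr drop.
  by move: szE sk; rewrite l1i; clear; lia.
set j := (_ - _)%N; rewrite -[X in (_ <= count _ X)%N](cat_take_drop j) count_cat.
exact: leq_addl.
Qed.

Section Algebra.
Variable R : realFieldType.
Notation pl := (plane R).
Implicit Types (a b c p q r u v w x y z : pl) (s t : R).

Definition cross u v : R := u.1 * v.2 - u.2 * v.1.
Definition vec a b : pl := (b.1 - a.1, b.2 - a.2).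
Definition orient a b c : R := cross (vec a b) (vec a c).
Definition side u q x : R := cross u (vec q x).
Definition mix t a b : pl := ((1 - t) * a.1 + t * b.1, (1 - t) * a.2 + t * b.2).
Definition ray x t u : pl := (x.1 + t * u.1, x.2 + t * u.2).
Definition on_seg a b x := exists2 t, 0 <= t <= 1 & x = mix t a b.

Lemma crossC u v : cross u v = - cross v u.
Proof. by rewrite /cross; ring. Qed.

Lemma side_mix u q t a b :
  side u q (mix t a b) = (1 - t) * side u q a + t * side u q b.
Proof. by rewrite /side /cross /=; ring. Qed.

Lemma side_ray u q x t d : side u q (ray x t d) = side u q x + t * cross u d.
Proof. by rewrite /side /cross /=; ring. Qed.

Lemma orient_rot a b c : orient a b c = orient b c a.
Proof. by rewrite /orient /cross /=; ring. Qed.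

Lemma orient_swap a b c : orient a b c = - orient a c b.
Proof. by rewrite /orient /cross /=; ring. Qed.

(** Angular order is transitive only within a half plane, here the one given by [n]; the identity is
    the Plucker relation between the four vectors. *)
Lemma cross_trans n g1 g2 g3 : 0 < cross n g1 -> 0 < cross n g2 ->
  0 < cross n g3 -> cross g1 g2 <= 0 -> cross g2 g3 <= 0 -> cross g1 g3 <= 0.
Proof.
move=> n1 n2 n3 h12 h23.
have E : cross n g2 * cross g1 g3 = cross n g1 * cross g2 g3 + cross n g3 * cross g1 g2.
  by rewrite /cross; ring.
rewrite -(pmulr_rle0 _ n2) E; nra.
Qed.

Lemma sum_pos_side t (f g : R) : 0 <= t <= 1 -> 0 <= f -> 0 <= g -> 0 <= (1 - t) * f + t * g.
Proof. by move=> /andP[t0 t1] f0 g0; apply: addr_ge0; apply: mulr_ge0 => //; lra. Qed.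

Section GP.
Variable X : {pred pl}.
Definition gp := forall a b c, a \in X -> b \in X -> c \in X ->
  a != b -> b != c -> a != c -> orient a b c != 0.
Hypothesis gpX : gp.

Lemma on_seg_vertex w a b : w \in X -> a \in X -> b \in X -> on_seg a b w ->
  w = a \/ w = b.
Proof.
move=> wX aX bX [t _ E]; case: (eqVneq w a) => [|wa]; first by left.
case: (eqVneq w b) => [|wb]; first by right.
case: (eqVneq a b) E => [-> E|ab E].
  by left; rewrite E /mix; case: (b) => *; congr pair => /=; ring.
have := gpX aX bX wX ab; rewrite !(eq_sym _ w) => /(_ wb wa)/eqP[].
by rewrite E /orient /cross /=; ring.
Qed.

Definition meets_ok (e e' : pl * pl) := forall x, on_seg e.1 e.2 x ->
  on_seg e'.1 e'.2 x -> (x = e.1 \/ x = e.2) /\ (x = e'.1 \/ x = e'.2).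
Definition simple (E : seq (pl * pl)) :=
  {in E &, forall e e', e != e' -> meets_ok e e'}.
Definition noncross (E E' : seq (pl * pl)) := {in E & E', forall e e', meets_ok e e'}.
Definition ends_in (P : pl -> Prop) (E : seq (pl * pl)) :=
  {in E, forall e, P e.1 /\ P e.2}.

Lemma simple_cat E E' : simple E -> simple E' -> noncross E E' -> simple (E ++ E').
Proof.
move=> sE sE' nE e e'; rewrite !mem_cat => /orP[eE|eE] /orP[eE'|eE'] ee'.
- exact: sE.
- exact: nE.
- by move=> x ex e'x; have [] := nE _ _ eE' eE x e'x ex.
- exact: sE'.
Qed.

(** A common point must be on the line, where [E'] has only y; general position then makes y an
    endpoint of both edges. *)
Lemma noncross_sep u q y E E' : y \in X ->
  ends_in (fun z => z \in X /\ 0 <= side u q z) E ->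
  ends_in (fun z => z \in X /\ (side u q z < 0 \/ z = y)) E' ->
  side u q y = 0 ->
  noncross E E'.
Proof.
move=> yX hE hE' y0 e e' eE e'E x ex e'x.
have [[e1X e1] [e2X e2]] := hE _ eE; have [[e1X' e1'] [e2X' e2']] := hE' _ e'E.
suff xy : x = y.
  split; rewrite xy.
    by rewrite xy in ex; exact: on_seg_vertex ex.
  by rewrite xy in e'x; exact: on_seg_vertex e'x.
case: ex => t t01 Ex; have := sum_pos_side t01 e1 e2; rewrite -side_mix -Ex {Ex}.
case: e'x => s /andP[s0 s1] ->; rewrite side_mix => h.
have [e1y|/eqP e1y] := eqVneq e'.1 y; have [e2y|/eqP e2y] := eqVneq e'.2 y.
- by rewrite e1y e2y /mix; case: (y) => *; congr pair => /=; ring.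
- case: e2' => // n2; rewrite e1y y0 in h.
  have -> : s = 0 by nra.
  by rewrite e1y /mix; case: (y) => *; congr pair => /=; ring.
- case: e1' => // n1; rewrite e2y y0 in h.
  have -> : s = 1 by nra.
  by rewrite e2y /mix; case: (y) => *; congr pair => /=; ring.
- case: e1' => // n1; case: e2' => // n2; exfalso; nra.
Qed.

Fixpoint edges a (s : seq pl) := if s is c :: s' then (a, c) :: edges c s' else [::].

Lemma edges_cat a y (s1 s2 : seq pl) :
  edges a (rcons s1 y ++ s2) = edges a (rcons s1 y) ++ edges y s2.
Proof. by elim: s1 a => [|c s1 IH] a //=; rewrite IH. Qed.

Lemma edges_ends (P : pl -> Prop) a (s : seq pl) :
  P a -> {in s, forall x, P x} -> ends_in P (edges a s).
Proof.
elim: s a => [|c s IH] a Pa Ps //= e; rewrite inE => /predU1P[-> /=|].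
  by split=> //; apply: Ps; rewrite mem_head.
by apply: IH => [|x xs]; apply: Ps; rewrite inE ?eqxx ?xs ?orbT.
Qed.

End GP.
End Algebra.

(** * Escaping to infinity *)

Section Escape.
Variable R : realFieldType.
Notation pl := (plane R).
Implicit Types (a b p q r u v w x y z : pl) (s t : R) (G : pl -> Prop).

(** A polygonal path that avoids G and ends with a ray. It stands in for membership of an unbounded
    component and makes sense over any ordered field. *)
Inductive escapes G : pl -> Prop :=
| escapes_ray x d : d != (0, 0) -> (forall t, 0 <= t -> ~ G (ray x t d)) -> escapes G x
| escapes_step x d t : 0 <= t -> (forall s, 0 <= s <= t -> ~ G (ray x s d)) ->
    escapes G (ray x t d) -> escapes G x.

Lemma ray0 x d : ray x 0 d = x.
Proof. by case: x => x1 x2; rewrite /ray /= !mul0r !addr0. Qed.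

Lemma ray_ray x s t d : ray (ray x s d) t d = ray x (s + t) d.
Proof. by rewrite /ray /=; congr pair; ring. Qed.

Lemma escapes_notin G x : escapes G x -> ~ G x.
Proof.
case=> {}x d; first by move=> _ /(_ 0 (lexx 0)); rewrite ray0.
by move=> t t0 /(_ 0); rewrite lexx t0 ray0 => /(_ isT).
Qed.

(* A constraint (q, u, sg) cuts out the open half plane [sg * side u q x < 0];
   its front ray starts at q in direction u. A point of the region that leaves
   it through the boundary of a constraint lands on the front ray ([escape_ray]),
   so it is enough to know that the front rays escape ([good]). *)
Notation constraint := (pl * pl * R)%type.
Definition cside (c : constraint) x : R := c.2 * side c.1.2 c.1.1 x.
Definition region (C : seq constraint) x := all (fun c => cside c x < 0) C.

(** A front ray is tested only where the constraints after it in the list hold. So a new constraint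
    can be put at the head as soon as its own front ray escapes within the old region. *)
Fixpoint good G (C : seq constraint) : Prop :=
  if C is c :: C' then
    good G C' /\ forall s, 0 < s -> region C' (ray c.1.1 s c.1.2) ->
                   escapes G (ray c.1.1 s c.1.2)
  else True.

Lemma cside_ray c x t d : cside c (ray x t d) = cside c x + t * (c.2 * cross c.1.2 d).
Proof. by rewrite /cside side_ray; ring. Qed.

Lemma region_between C x d s t : 0 <= s <= t -> region C x -> region C (ray x t d) ->
  region C (ray x s d).
Proof.
move=> /andP[s0 st] /allP h0 /allP ht; apply/allP => c cC.
have := h0 c cC; have := ht c cC; rewrite !cside_ray.
set A := cside c x; set B := _ * cross _ _ => h1 h2.
have [B0|/ltW B0] := lerP 0 B; nra.
Qed.

Lemma escape_ray G C x d : d != (0, 0) -> region C x ->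
  {in C, forall c, 0 < c.2 * cross d (vec x c.1.1)} ->
  (forall t, 0 <= t -> region C (ray x t d) -> ~ G (ray x t d)) ->
  good G C -> escapes G x.
Proof.
move=> dn0; elim: C => [|c C IH] /= xC hC av gC.
  by apply: (escapes_ray dn0) => t t0; apply: av.
have /andP[cx Cx] := xC; have [{}gC gc] := gC.
have hC' : {in C, forall c, 0 < c.2 * cross d (vec x c.1.1)}.
  by move=> c' c'C; apply: hC; rewrite inE c'C orbT.
set k := c.2 * cross c.1.2 d; set f := cside c x in cx.
have [k0|k0] := lerP k 0.
  apply: IH => // t t0 Ct; apply: av => //; rewrite Ct andbT cside_ray -/f -/k; nra.
set T := - f / k; have T0 : 0 < T by rewrite divr_gt0 // oppr_gt0.
have Tk : T * k = - f by rewrite divfK ?gt_eqF.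
have before t : t < T -> cside c (ray x t d) < 0.
  by move=> tT; rewrite cside_ray -/f -/k -(addrN f) -Tk ltrD2l ltr_pM2r.
case CT: (region C (ray x T d)); last first.
  apply: IH => // t t0 Ct; have [tT|tT] := ltP t T.
    by apply: av => //; rewrite before.
  by case/negP: CT; apply: region_between Ct; rewrite ?(ltW T0).
(* Cramer's rule: the position of the crossing point on the front ray of [c]. *)
set s := (c.2 * cross d (vec x c.1.1)) / k.
have s0 : 0 < s by rewrite divr_gt0 // hC // mem_head.
have Es : ray x T d = ray c.1.1 s c.1.2.
  have kn0 : k != 0 by rewrite gt_eqF.
  have ks : s * k = c.2 * cross d (vec x c.1.1) by rewrite divfK.
  clearbody s T; congr pair; apply: (mulIf kn0); rewrite !(mulrDl, mulrAC _ _ k) Tk ks;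
    by rewrite /f /k /cside /side /cross /vec /=; ring.
apply: (@escapes_step _ _ d T (ltW T0)); last first.
  by rewrite Es; apply: gc => //; rewrite -Es.
move=> t /andP[t0]; rewrite le_eqVlt => /predU1P[-> | tT].
  by apply: escapes_notin; rewrite Es; apply: gc => //; rewrite -Es.
apply: av => //; rewrite before //=; apply: region_between CT => //.
by rewrite t0 ltW.
Qed.
End Escape.

Lemma perm_split (T : eqType) (S s1 s2 : seq T) y (A : pred T) :
  uniq S -> y \in S ->
  perm_eq s1 [seq x <- S | (x != y) && A x] ->
  perm_eq s2 [seq x <- S | (x != y) && ~~ A x] -> perm_eq (s1 ++ y :: s2) S.
Proof.
move=> uS yS p1 p2; rewrite perm_sym (permPl (perm_to_rem yS)) perm_sym.
rewrite -cat1s perm_catCA /= perm_cons rem_filter //.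
rewrite perm_sym -(perm_filterC A [seq x <- S | predC1 y x]) -!filter_predI perm_sym.
by apply: perm_cat; [apply: perm_trans p1 _|apply: perm_trans p2 _];
  rewrite (@eq_filter _ _ _ (fun x => andbC _ _)).
Qed.

Section SimplePaths.
Variable R : realFieldType.
Notation pl := (plane R).
Implicit Types (a b p q r u v w x y z : pl) (t : R).
Notation constraint := (pl * pl * R)%type.
Implicit Types (C : seq constraint).

Lemma sort_directions (T : eqType) (g : T -> pl) n (L : seq T) :
  {in L, forall i, 0 < cross n (g i)} ->
  exists2 L', perm_eq L' L & pairwise (fun i j => cross (g i) (g j) <= 0) L'.
Proof.
move=> nL; set le := fun i j => _ <= _.
exists (sort le L); first by rewrite perm_sort.
rewrite -(@sorted_pairwise_in _ [pred i | 0 < cross n (g i)]).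
- apply: sort_sorted => i j; rewrite /le (crossC (g j)) oppr_le0; exact: le_total.
- by move=> j i k hj hi hk; apply: (cross_trans hi hj hk).
- by apply/allP => i; rewrite mem_sort => /nL.
Qed.

Lemma side0 u q : side u q q = 0.
Proof. by rewrite /side /cross /= !subrr !mulr0 subrr. Qed.

Definition on_edge (E : seq (pl * pl)) x := exists2 e : pl * pl, e \in E & on_seg e.1 e.2 x.

Variable X : {pred pl}.
Hypothesis gpX : gp X.

Lemma path_splice u a y b s1 s2 : a \in X -> b \in X -> y \in X ->
  {subset s1 <= X} -> {subset s2 <= X} ->
  0 < side u y a -> side u y b < 0 ->
  {in s1, forall x, 0 <= side u y x} -> {in s2, forall x, side u y x < 0} ->
  simple (edges a (rcons s1 y)) -> simple (edges y (rcons s2 b)) ->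
  simple (edges a (rcons (s1 ++ y :: s2) b)).
Proof.
move=> aX bX yX s1X s2X ha hb h1 h2 sm1 sm2.
rewrite rcons_cat rcons_cons -cat_rcons edges_cat.
apply: simple_cat => //; apply: (@noncross_sep _ _ gpX u y y) (side0 _ _) => //.
  apply: edges_ends; first by rewrite aX ltW.
  move=> x; rewrite mem_rcons inE => /predU1P[->|xs]; first by rewrite yX side0.
  by rewrite s1X ?h1.
apply: edges_ends; first by split=> //; right.
move=> x; rewrite mem_rcons inE => /predU1P[->|xs]; first by split=> //; left.
by split; [exact: s2X | left; exact: h2].
Qed.

(** The base case of [escaping_path]: with no red point left, any cut through a point of S that
    separates a from b will do. *)
Lemma leaf_path a b S : a \in X -> b \in X -> {subset S <= X} -> a != b ->
  uniq S -> a \notin S -> b \notin S ->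
  exists2 s, perm_eq s S & simple (edges a (rcons s b)).
Proof.
have [n le_n] := ubnP (size S); elim: n => // n IH in a b S le_n *.
case: S le_n => [|y S'] /= sn aX bX SX ab uS aS bS.
  by exists [::] => // e e'; rewrite /= !inE => /eqP-> /eqP->; rewrite eqxx.
set S := y :: S' in SX aS bS uS *.
have yS : y \in S by rewrite mem_head.
have yX : y \in X by apply: SX.
have ay : a != y by apply: contraNneq aS => ->.
have yb : y != b by apply: contraNneq bS => <-.
(* split by the line through y and the midpoint of a b *)
have [u [ua ub]] : exists u, 0 < side u y a /\ side u y b < 0.
  pose u : pl := (a.1 + b.1 - 2 * y.1, a.2 + b.2 - 2 * y.2).
  have Ea : side u y a = orient y b a by rewrite /side /orient /cross /=; ring.
  have Eb : side u y b = - orient y b a by rewrite /side /orient /cross /=; ring.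
  have := gpX yX bX aX yb; rewrite eq_sym ab eq_sym ay => /(_ isT isT).
  case: ltgtP => // h _.
    exists (- u.1, - u.2); rewrite -[side _ y a]opprK -[side _ y b]opprK.
    have E x : - side (- u.1, - u.2) y x = side u y x by rewrite /side /cross /=; ring.
    by rewrite !E Ea Eb; lra.
  by exists u; rewrite Ea Eb; lra.
pose A x := 0 <= side u y x.
pose S1 := [seq x <- S | (x != y) && A x]; pose S2 := [seq x <- S | (x != y) && ~~ A x].
have sz (B : pred pl) : (size [seq x <- S | (x != y) && B x] < n)%N.
  rewrite /S /= eqxx /=; apply: leq_ltn_trans (_ : size S' < n)%N; last exact: sn.
  by rewrite size_filter; exact: count_size.
have nS1 x : x \notin S -> x \notin S1 by apply: contraNN; rewrite mem_filter => /andP[].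
have nS2 x : x \notin S -> x \notin S2 by apply: contraNN; rewrite mem_filter => /andP[].
have [|||||s1 p1 sm1] := IH a y S1 (sz _) aX yX => //.
- by move=> x; rewrite mem_filter => /andP[_ /SX].
- by rewrite filter_uniq.
- exact: nS1.
- by rewrite mem_filter eqxx.
have [|||||s2 p2 sm2] := IH y b S2 (sz _) yX bX => //.
- by move=> x; rewrite mem_filter => /andP[_ /SX].
- by rewrite filter_uniq.
- by rewrite mem_filter eqxx.
- exact: nS2.
exists (s1 ++ y :: s2); first exact: perm_split p1 p2.
apply: (path_splice (u := u)) => //.
- by move=> x; rewrite (perm_mem p1) mem_filter => /andP[_ /SX].
- by move=> x; rewrite (perm_mem p2) mem_filter => /andP[_ /SX].
- by move=> x; rewrite (perm_mem p1) mem_filter => /andP[/andP[]].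
- by move=> x; rewrite (perm_mem p2) mem_filter -ltNge => /andP[/andP[]].
Qed.

Definition dot u v : R := u.1 * v.1 + u.2 * v.2.

(** This keeps edges off the front half of a cutting line. A segment on one closed side of the line
    meets it only in an endpoint or lies in it, so it is enough that endpoints on the line are not
    in front of y. *)
Lemma seg_side_dot k u y z1 z2 x :
  0 <= k * side u y z1 -> (side u y z1 = 0 -> dot u (vec y z1) <= 0) ->
  0 <= k * side u y z2 -> (side u y z2 = 0 -> dot u (vec y z2) <= 0) ->
  k != 0 -> on_seg z1 z2 x -> side u y x = 0 -> dot u (vec y x) <= 0.
Proof.
move=> h1 d1 h2 d2 k0 [t /andP[t0 t1] ->]; rewrite side_mix => E.
have -> : dot u (vec y (mix t z1 z2)) = (1 - t) * dot u (vec y z1) + t * dot u (vec y z2).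
  by rewrite /dot /vec /=; ring.
have Ek : (1 - t) * (k * side u y z1) + t * (k * side u y z2) = 0.
  by rewrite -[RHS](mulr0 k) -E; ring.
have [e1|e1] := eqVneq (side u y z1) 0; have [e2|e2] := eqVneq (side u y z2) 0.
- by have := d1 e1; have := d2 e2; nra.
- move: E; rewrite e1 mulr0 add0r => /eqP; rewrite mulf_eq0 (negPf e2) orbF => /eqP ->.
  by have := d1 e1; lra.
- move: E; rewrite e2 mulr0 addr0 => /eqP; rewrite mulf_eq0 (negPf e1) orbF => /eqP h.
  have -> : t = 1 by lra.
  by have := d2 e2; lra.
- have p1 : 0 < k * side u y z1 by rewrite lt0r h1 mulf_neq0.
  have p2 : 0 < k * side u y z2 by rewrite lt0r h2 mulf_neq0.
  by exfalso; nra.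
Qed.
End SimplePaths.

(** * Paths that let a set of points escape *)

Section Top.
Variable R : realFieldType.
Notation pl := (plane R).
Implicit Types (a b p q r u v w x y z : pl) (t k : R).
Notation constraint := (pl * pl * R)%type.
Implicit Types (C : seq constraint).
Variable X : {pred pl}.
Hypothesis gpX : gp X.

(* The path E lets the red points Rd escape from any curve G that coincides
   with E inside a good region containing Rd. *)
Definition escaping (P Rd : seq pl) E := forall G C, good G C ->
  {in C & P, forall c p, {in Rd, forall r, 0 < c.2 * orient p r c.1.1}} ->
  (forall x, region C x -> G x -> on_edge E x) ->
  {in Rd, forall r, region C r} -> {in Rd, forall r, escapes G r}.

(** With y extreme in angle around b, the directions from y to the red points and from the other
    points of P to y all lie in one half plane, where they can be sorted. *)
Lemma first_seen b w P : {subset P <= X} -> b \in X -> b \notin P -> uniq P ->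
  {in P, forall p, 0 < side w b p} -> (0 < size P)%N ->
  exists2 y, y \in P & {in P, forall p, p != y -> orient y b p < 0}.
Proof.
move=> PX bX bP uP wP.
have [P' pP' ] := sort_directions (g := vec b) wP.
case/lastP: P' pP' => [|P' y] pP' sP'; first by rewrite -(perm_size pP').
move=> _; exists y; first by rewrite -(perm_mem pP') mem_rcons mem_head.
move=> p pP py; have pP'' : p \in P'.
  by move: pP; rewrite -(perm_mem pP') mem_rcons inE (negPf py).
have yP : y \in P by rewrite -(perm_mem pP') mem_rcons mem_head.
move: sP'; rewrite pairwise_rcons => /andP[/allP /(_ _ pP'') h _].
have yb : y != b by apply: contraNneq bP => <-.
have bp : b != p by apply: contraNneq bP => ->.
have := gpX (PX _ yP) bX (PX _ pP) yb bp; rewrite eq_sym py => /(_ isT) n0.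
rewrite lt_neqAle n0 /=; move: h; rewrite /orient /cross /=; lra.
Qed.

(* Induction on the red points: the path is cut at the point y of P seen first
   from b, by a line through y and another point x0 given by [cut_balanced]. The
   reds on one side see the points kept on that side as they see a and y (or y
   and b), and a red x0 escapes along the line itself. *)
Lemma escaping_path n a b w (P S Rd : seq pl) : (size Rd < n)%N -> a \in X -> b \in X ->
  {subset S <= X} -> {subset Rd <= X} -> a != b -> uniq S -> uniq P ->
  {subset P <= S} -> uniq Rd -> a \notin S -> b \notin S ->
  {in Rd, forall r, r \notin S} ->
  {in P & Rd, forall p r, 0 < orient p r a} ->
  {in P & Rd, forall p r, orient p r b < 0} ->
  {in P, forall p, 0 < side w b p} ->
  (3 * size Rd <= size P + 2)%N ->
  exists s, [/\ perm_eq s S, simple (edges a (rcons s b)) &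
    escaping P Rd (edges a (rcons s b))].
Proof.
elim: n => // n IH in a b w P S Rd *.
rewrite ltnS leq_eqVlt => /predU1P[sn|sn]; last exact: IH.
move=> aX bX SX RX ab uS uP PS uR aS bS RS Pa Pb Pw sizP.
have [R0|R0] := posnP (size Rd).
  have [s ps sm] := leaf_path gpX aX bX SX ab uS aS bS.
  by exists s; split=> // G C _ _ _ _ r; rewrite (size0nil R0).
have PX : {subset P <= X} by move=> p /PS /SX.
have bP : b \notin P by apply: contraNN bS => /PS.
have [] := first_seen PX bX bP uP Pw; first by move: sizP R0; move: (size Rd) (size P); clear; lia.
move=> y yP ymin.
have yS := PS _ yP; have yX := SX _ yS.
have yb : y != b by apply: contraNneq bS => <-.
have ay : a != y by apply: contraNneq aS => ->.
have yR : y \notin Rd by apply/negP => /RS; rewrite yS.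
have RP r : r \in Rd -> r \notin P by move=> /RS; apply: contraNN => /PS.
pose red := mem Rd; pose L := [seq p <- P | p != y] ++ Rd.
(* Blue directions are reversed. The cutting direction thus points towards a red [x0] but away from
   a blue one, which stays behind y. Moreover the side on which a blue and a red point see y is
   given by their order in the sorted list. *)
pose g x := if x \in Rd then vec y x else vec x y.
pose nn := vec y b.
have inL x : x \in L = (x \in P) && (x != y) || (x \in Rd).
  by rewrite mem_cat mem_filter andbC.
have gL : {in L, forall x, 0 < cross nn (g x)}.
  move=> x; rewrite inL /g; case: ifP => [xR _|_]; last first.
    rewrite orbF => /andP[xP xy]; have := ymin _ xP xy.
    by rewrite /nn /orient /cross /=; lra.
  by have := Pb _ _ yP xR; rewrite /nn /orient /cross /=; lra.
have LX : {subset L <= X} by move=> x; rewrite inL => /orP[/andP[/PX]|/RX].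
have Ly x : x \in L -> x != y.
  by rewrite inL => /orP[/andP[]|xR] //; apply: contraNneq yR => <-.
have gnz x x' : x \in L -> x' \in L -> x != x' -> cross (g x) (g x') != 0.
  move=> xL x'L xx'.
  have := gpX yX (LX _ xL) (LX _ x'L); rewrite xx' eq_sym Ly // eq_sym Ly //.
  move=> /(_ isT isT isT); apply: contraNneq => h; apply/eqP; move: h.
  by rewrite /g /orient /cross; do 2!case: ifP => _ /=; clear; lra.
have [L' pL' sL'] := sort_directions gL.
have uL : uniq L.
  rewrite cat_uniq filter_uniq // uR andbT; apply/hasPn => x xR.
  by rewrite mem_filter negb_and (RP _ xR) orbT.
have cR : count red L = size Rd.
  rewrite count_cat (eqP (_ : count red [seq p <- P | p != y] == 0%N)).
    by apply/eqP; rewrite -all_count; apply/allP.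
  rewrite -leqn0 leqNgt -has_count; apply/hasPn => x; rewrite mem_filter.
  by case/andP => _ xP; apply/negP => /RP; rewrite xP.
have cL : (count red L + count (predC red) L = size P + size Rd - 1)%N.
  rewrite count_predC size_cat -rem_filter // size_rem //.
  by move: sizP R0; clear; case: (size P) => [|k] /=; lia.
have := cut_balanced (red := red) (l := L').
rewrite !(permP pL') cR => /(_ R0) []; first by move: cL; rewrite cR; move: sizP R0; clear; lia.
move=> l1 [x0 [l2 [El c1 c2 x0c]]].
have uL' : uniq L' by rewrite (perm_uniq pL').
have memL x : x \in L = [|| x \in l1, x == x0 | x \in l2].
  by rewrite -(perm_mem pL') El mem_cat inE.
move: sL'; rewrite El pairwise_cat pairwise_cons allrel_consr.
move=> /and4P[/andP[/allP l1x0 /allrelP l12] _ /allP x0l2 _].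
move: uL'; rewrite El cat_uniq /= negb_or => /and3P[_ /andP[x0l1 /hasPn dl] /andP[x0l2n _]].
have x0L : x0 \in L by rewrite memL eqxx orbT.
have l1L : {subset l1 <= L} by move=> x xl; rewrite memL xl.
have l2L : {subset l2 <= L} by move=> x xl; rewrite memL xl !orbT.
set u := g x0.
have before x : x \in l1 -> cross (g x) u < 0.
  move=> xl; rewrite lt_neqAle (gnz _ _ (l1L _ xl) x0L) ?l1x0 //.
  by apply: contraNneq x0l1 => <-.
have after x : x \in l2 -> cross u (g x) < 0.
  move=> xl; rewrite lt_neqAle (gnz _ _ x0L (l2L _ xl)) ?x0l2 //.
  by apply: contraNneq x0l2n => ->.
have across x x' : x \in l1 -> x' \in l2 -> cross (g x) (g x') < 0.
  move=> xl x'l; rewrite lt_neqAle (gnz _ _ (l1L _ xl) (l2L _ x'l)) ?l12 //.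
  by apply: contraTneq (dl _ x'l) => <-; rewrite negbK.
have gred x : x \in Rd -> g x = vec y x by rewrite /g => ->.
have gpoint x : x \notin Rd -> g x = vec x y by rewrite /g => /negPf ->.
have sred x : x \in Rd -> side u y x = cross u (g x) by move/gred ->.
have spoint x : x \notin Rd -> side u y x = - cross u (g x).
  by move/gpoint ->; rewrite /side /cross /=; ring.
(* The path from a to y keeps blue points after the cut and red points before it: exactly such pairs
   see y on the side required of the second endpoint. The path from y to b takes the opposite
   pairs. *)
pose PL := [seq x <- l2 | predC red x]; pose RL := [seq x <- l1 | red x].
pose PR := [seq x <- l1 | predC red x]; pose RR := [seq x <- l2 | red x].
have PLP x : x \in PL -> [/\ x \in P, x != y, x \in l2 & x \notin Rd].
  rewrite mem_filter /= => /andP[xR xl]; have := l2L _ xl.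
  by rewrite inL (negPf xR) orbF => /andP[].
have PRP x : x \in PR -> [/\ x \in P, x != y, x \in l1 & x \notin Rd].
  rewrite mem_filter /= => /andP[xR xl]; have := l1L _ xl.
  by rewrite inL (negPf xR) orbF => /andP[].
have RLR x : x \in RL -> x \in Rd /\ x \in l1 by rewrite mem_filter => /andP[].
have RRR x : x \in RR -> x \in Rd /\ x \in l2 by rewrite mem_filter => /andP[].
have cR' : size Rd = (size RL + (red x0 + size RR))%N.
  by rewrite -cR -(permP pL') El count_cat /= !size_filter.
have oy p r : p \in P -> r \in Rd -> orient p r y = cross (g r) (g p).
  move=> pP rR; rewrite gred // gpoint; last by apply/negP => /RP; rewrite pP.
  by rewrite /orient /cross /=; ring.
(* For a blue [x0], the direction [u] lies between red directions before and after it, so the sides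
   of q given by these two red points determine its side of the cutting line. *)
have toward q k : {in P & Rd, forall p r, 0 < k * orient p r q} -> 0 < k * side u y q.
  move=> kq; case/orP: x0c => [x0R|].
    by have := kq _ _ yP x0R; rewrite /u gred.
  rewrite -!has_count => /andP[/hasP[r1 r1l r1R] /hasP[r2 r2l r2R]].
  have := across _ _ r1l r2l; have := before _ r1l; have := after _ r2l.
  have := kq _ _ yP r1R; have := kq _ _ yP r2R.
  rewrite /orient /side -(gred r1) // -(gred r2) //; set q' := vec y q => h2 h1 a2 b1 a12.
  have E : cross (g r1) (g r2) * (k * cross u q') =
     cross u (g r2) * (k * cross (g r1) q') + cross (g r1) u * (k * cross (g r2) q').
    by rewrite /cross; ring.
  rewrite -(nmulr_rlt0 _ a12) E addrC -(addr0 0) ltrD // ?nmulr_rlt0 //.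
have ua : 0 < side u y a.
  by have := @toward a 1; rewrite mul1r; apply=> p r pP rR; rewrite mul1r Pa.
have ub : side u y b < 0.
  have := @toward b (-1); rewrite mulN1r oppr_gt0; apply=> p r pP rR.
  by rewrite mulN1r oppr_gt0 Pb.
pose A x := 0 <= side u y x.
pose SL := [seq x <- S | (x != y) && A x]; pose SR := [seq x <- S | (x != y) && ~~ A x].
have SLP x : x \in SL -> [/\ x \in S, x != y & 0 <= side u y x].
  by rewrite mem_filter => /andP[/andP[]].
have SRP x : x \in SR -> [/\ x \in S, x != y & side u y x < 0].
  by rewrite mem_filter -ltNge => /andP[/andP[]].
have sizL : size RL = count red l1 by rewrite size_filter.
have sizR : size RR = count red l2 by rewrite size_filter.
have ltL : (size RL < n)%N.
  rewrite -sn cR'; case/orP: x0c => [->|]; first by clear; lia.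
  by rewrite sizL sizR => /andP[_]; clear; lia.
have ltR : (size RR < n)%N.
  rewrite -sn cR'; case/orP: x0c => [->|]; first by clear; lia.
  by rewrite sizL sizR => /andP[+ _]; clear; lia.
have PLs x : x \in PL -> 0 < side u y x.
  by case/PLP => _ _ xl xR; rewrite spoint // oppr_gt0 after.
have PRs x : x \in PR -> side u y x < 0.
  by case/PRP => _ _ xl xR; rewrite spoint // oppr_lt0 crossC oppr_gt0 before.
have [ul1 ul2] : uniq l1 /\ uniq l2.
  by move: uL; rewrite -(perm_uniq pL') El cat_uniq /= => /and3P[-> _ /andP[_ ->]].
have SLX : {subset SL <= X} by move=> x /SLP[/SX].
have SRX : {subset SR <= X} by move=> x /SRP[/SX].
have RLX : {subset RL <= X} by move=> x /RLR[/RX].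
have RRX : {subset RR <= X} by move=> x /RRR[/RX].
have PLS : {subset PL <= SL}.
  by move=> x xPL; have [xP xy _ _] := PLP _ xPL; rewrite mem_filter xy /A ltW ?PLs ?PS.
have PRS : {subset PR <= SR}.
  by move=> x xPR; have [xP xy _ _] := PRP _ xPR; rewrite mem_filter xy /A -ltNge PRs ?PS.
have aSL : a \notin SL by apply: contraNN aS => /SLP[].
have bSR : b \notin SR by apply: contraNN bS => /SRP[].
have ySL : y \notin SL by apply/negP => /SLP[_]; rewrite eqxx.
have ySR : y \notin SR by apply/negP => /SRP[_]; rewrite eqxx.
have RLS : {in RL, forall r, r \notin SL}.
  by move=> r /RLR[rR _]; apply: contraNN (RS _ rR) => /SLP[].
have RRS : {in RR, forall r, r \notin SR}.
  by move=> r /RRR[rR _]; apply: contraNN (RS _ rR) => /SRP[].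
have PLa : {in PL & RL, forall p r, 0 < orient p r a}.
  by move=> p r /PLP[pP _ _ _] /RLR[rR _]; apply: Pa.
have PLy : {in PL & RL, forall p r, orient p r y < 0}.
  by move=> p r /PLP[pP _ pl2 _] /RLR[rR rl1]; rewrite oy // across.
have PRb : {in PR & RR, forall p r, orient p r b < 0}.
  by move=> p r /PRP[pP _ _ _] /RRR[rR _]; apply: Pb.
have PRy : {in PR & RR, forall p r, 0 < orient p r y}.
  by move=> p r /PRP[pP _ pl1 _] /RRR[rR rl2]; rewrite oy // crossC oppr_gt0 across.
have PRw : {in PR, forall p, 0 < side w b p} by move=> p /PRP[pP _ _ _]; apply: Pw.
have szPL : (3 * size RL <= size PL + 2)%N by rewrite sizL size_filter.
have szPR : (3 * size RR <= size PR + 2)%N by rewrite sizR size_filter.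
have [sL [pL smL escL]] := IH a y u PL SL RL ltL aX yX SLX RLX ay
  (filter_uniq _ uS) (filter_uniq _ ul2) PLS (filter_uniq _ ul1) aSL ySL RLS PLa PLy PLs szPL.
have [sR [pR smR escR]] := IH y b w PR SR RR ltR yX bX SRX RRX yb
  (filter_uniq _ uS) (filter_uniq _ ul1) PRS (filter_uniq _ ul2) ySR bSR RRS PRy PRb PRw szPR.
have sLP x : x \in sL -> [/\ x \in S, x != y & 0 <= side u y x].
  by rewrite (perm_mem pL) => /SLP.
have sRP x : x \in sR -> [/\ x \in S, x != y & side u y x < 0].
  by rewrite (perm_mem pR) => /SRP.
exists (sL ++ y :: sR); split; first exact: perm_split pL pR.
  apply: (path_splice gpX (u := u)) => //.
  - by move=> x /sLP[/SX].
  - by move=> x /sRP[/SX].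
  - by move=> x /sLP[].
  - by move=> x /sRP[].
have n0 : 0 < dot u u.
  have := gL _ x0L; rewrite -/u /dot /cross; case: (u) => u1 u2 /= h.
  have [u10|u10] := eqVneq u1 0; last first.
    by apply: ltr_pwDl; rewrite -expr2 ?exprn_even_gt0 //= sqr_ge0.
  have u20 : u2 != 0 by apply: contraTneq h => ->; rewrite u10 !mulr0 subrr ltxx.
  by apply: ltr_wpDl; rewrite -expr2 ?exprn_even_gt0 //= sqr_ge0.
have un0 : u != (0, 0).
  by apply: contraTneq n0 => ->; rewrite /dot /= !mulr0 addr0 ltxx.
rewrite rcons_cat rcons_cons -cat_rcons edges_cat.
set EL := edges a _; set ER := edges y _.
have dy : dot u (vec y y) <= 0 by rewrite /dot /vec /= !subrr !mulr0 addr0.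
(* By general position the line contains no vertex of this path but y and possibly a blue [x0],
   which is behind y. *)
have onL x : on_edge EL x -> 0 <= side u y x /\ (side u y x = 0 -> dot u (vec y x) <= 0).
  have ends : ends_in (fun z => 0 <= 1 * side u y z /\
      (side u y z = 0 -> dot u (vec y z) <= 0)) EL.
    apply: edges_ends; rewrite ?mul1r; first by rewrite ltW //; split=> // h; move: ua; rewrite h ltxx.
    move=> z; rewrite mem_rcons inE => /predU1P[->|zs]; first by rewrite mul1r side0.
    have [zS zy z0] := sLP _ zs; rewrite mul1r; split=> // zu.
    case x0R: (x0 \in Rd).
      have zx0 : x0 != z by apply: contraTneq zS => <-; apply: RS.
      have := gpX yX (LX _ x0L) (SX _ zS); rewrite zx0 eq_sym Ly // eq_sym zy.
      by rewrite /orient -gred // -/u -/(side u y z) zu eqxx => /(_ isT isT isT).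
    have [zx0|zx0] := eqVneq x0 z.
      by rewrite -zx0; move: n0; rewrite /u gpoint ?x0R // /dot /=; clear; lra.
    have := gpX yX (LX _ x0L) (SX _ zS); rewrite zx0 eq_sym Ly // eq_sym zy.
    move=> /(_ isT isT isT)/eqP[]; rewrite -[RHS]oppr0 -zu /u gpoint ?x0R //.
    by rewrite /orient /side /cross /=; ring.
  case=> e eE xe; have [[s1 d1] [s2 d2]] := ends _ eE; split.
    by case: xe => t t01 ->; rewrite side_mix; rewrite mul1r in s1; rewrite mul1r in s2; exact: sum_pos_side.
  by apply: (seg_side_dot s1 d1 s2 d2 _ xe); rewrite oner_neq0.
have onR x : on_edge ER x -> side u y x <= 0 /\ (side u y x = 0 -> dot u (vec y x) <= 0).
  have ends : ends_in (fun z => 0 <= -1 * side u y z /\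
      (side u y z = 0 -> dot u (vec y z) <= 0)) ER.
    apply: edges_ends; first by rewrite side0 mulr0.
    move=> z; rewrite mem_rcons inE mulN1r oppr_ge0 => /predU1P[->|zs].
      by rewrite ltW //; split=> // h; move: ub; rewrite h ltxx.
    have [_ _ h] := sRP _ zs; rewrite ltW //; split=> // h0; move: h; rewrite h0 ltxx //.
  case=> e eE xe; have [[s1 d1] [s2 d2]] := ends _ eE; split.
    case: xe => t t01 ->; rewrite side_mix -oppr_ge0 opprD -!mulrN.
    by rewrite mulN1r in s1; rewrite mulN1r in s2; exact: sum_pos_side.
  by apply: (seg_side_dot s1 d1 s2 d2 _ xe); rewrite oppr_eq0 oner_neq0.
have memE x : on_edge (EL ++ ER) x -> on_edge EL x \/ on_edge ER x.
  by case=> e; rewrite mem_cat => /orP[eE|eE] xe; [left|right]; exists e.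
have front t : 0 < t -> ~ on_edge (EL ++ ER) (ray y t u).
  move=> t0 /memE h; have s0 : side u y (ray y t u) = 0.
    by rewrite side_ray side0 /cross; ring.
  have : dot u (vec y (ray y t u)) <= 0 by case: h => [/onL|/onR] [_]; apply.
  have -> : dot u (vec y (ray y t u)) = t * dot u u by rewrite /dot /=; ring.
  by rewrite leNgt mulr_gt0.
move=> G C gC CP CG CR.
(* A point of the front ray flees along this ray itself; by [toward], it can leave the older
   constraints only through their front rays. *)
have gfront s : 0 < s -> region C (ray y s u) -> escapes G (ray y s u).
  move=> s0 Cs; apply: (escape_ray un0 Cs _ _ gC).
    move=> c cC; have -> : cross u (vec (ray y s u) c.1.1) = side u y c.1.1.
      by rewrite /side /cross /=; ring.
    by apply: toward => p r pP rR; apply: CP.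
  move=> t t0; rewrite ray_ray => Ct /(CG _ Ct); apply: front; exact: ltr_wpDr.
move=> r rR; have : r \in L by rewrite inL rR orbT.
rewrite memL => /or3P[rl1|/eqP rx0|rl2].
- apply: (escL G ((y, u, -1) :: C)) => //.
  + move=> c p; rewrite inE => /predU1P[->|cC] pP r' r'R /=.
      by rewrite mulN1r oppr_gt0 PLy.
    by apply: CP => //; [have [] := PLP _ pP | have [] := RLR _ r'R].
  + move=> x /= /andP[xc Cx] Gx; have /memE[//|/onR[]] := CG _ Cx Gx.
    by move: xc; rewrite /cside /=; clear; lra.
  + move=> r' r'R /=; have [r'Rd r'l1] := RLR _ r'R; rewrite CR // andbT.
    by rewrite /cside /= mulN1r oppr_lt0 sred // crossC oppr_gt0 before.
  + by rewrite mem_filter /= rR.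
- have Er : r = ray y 1 u.
    by rewrite /u -rx0 gred // /ray; case: (r) => r1 r2 /=; congr pair; ring.
  by rewrite Er; apply: gfront; rewrite ?ltr01 // -Er CR.
- apply: (escR G ((y, u, 1) :: C)) => //.
  + move=> c p; rewrite inE => /predU1P[->|cC] pP r' r'R /=.
      by rewrite mul1r PRy.
    by apply: CP => //; [have [] := PRP _ pP | have [] := RRR _ r'R].
  + move=> x /= /andP[xc Cx] Gx; have /memE[/onL[]|//] := CG _ Cx Gx.
    by move: xc; rewrite /cside /=; clear; lra.
  + move=> r' r'R /=; have [r'Rd r'l2] := RRR _ r'R; rewrite CR // andbT.
    by rewrite /cside /= mul1r sred // after.
  + by rewrite mem_filter /= rR.
Qed.
End Top.

(** * Vertices of the convex hull *)

Lemma count_sub_eq (T : eqType) (P Q : pred T) (s : seq T) :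
  {in s, forall i, P i -> Q i} -> count P s = count Q s -> {in s, P =1 Q}.
Proof.
elim: s => //= i s IH PQ E.
have PQs : {in s, forall j, P j -> Q j} by move=> j js; apply: PQ; rewrite inE js orbT.
have le : (count P s <= count Q s)%N.
  have <- : count P [seq j <- s | Q j] = count P s.
    rewrite count_filter (eq_in_count (a2 := P)) // => j js /=.
    by case Pj: (P j) => //=; rewrite PQs.
  by rewrite -[count Q s]size_filter count_size.
have := PQ i (mem_head _ _) => PQi.
have [Ei Es] : P i = Q i /\ count P s = count Q s.
  by move: E le PQi; case: (P i); case: (Q i) => /= E le // h; split=> //; move: h E le; clear; lia.
by move=> j; rewrite inE => /predU1P[->|/(IH PQs Es)].
Qed.

Lemma pigeonhole (T : eqType) (f : T -> nat) m N (s : seq T) :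
  {in s, forall i, f i < m}%N -> (m * N <= size s)%N -> (0 < m)%N ->
  exists j, (N <= size [seq i <- s | f i == j])%N.
Proof.
elim: m s => // m IH s fs sz _.
have [le|gt] := leqP N (size [seq i <- s | f i == m]); first by exists m.
case: m => [|m] in IH fs sz gt *.
  exists 0%N; rewrite (eq_in_filter (a2 := predT)) ?filter_predT; first by rewrite mul1n in sz.
  by move=> i /fs; rewrite ltnS leqn0.
have [|||j Nj] := IH [seq i <- s | f i != m.+1] => //.
- by move=> i; rewrite mem_filter => /andP[n /fs]; rewrite ltnS leq_eqVlt (negPf n).
- have := count_predC (fun i => f i == m.+1) s; rewrite -!size_filter.
  by move: sz gt; rewrite mulSn; move: (size _) (size _) (size _); clear; lia.
exists j; apply: leq_trans Nj _; rewrite -filter_predI !size_filter.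
by apply: sub_count => i /= /andP[].
Qed.

Section Hull.
Variable R : realFieldType.
Notation pl := (plane R).
Implicit Types (a b c p q r u v w x y z : pl) (t k : R).
Variable X : seq pl.
Hypothesis gpX : gp (mem X).

(** Strict support, unlike extremality, directly provides the half plane needed to sort directions
    around z. [hull_vertex_extreme] makes the link. *)
Definition hull_vertex z := exists u, {in X, forall y, y != z -> 0 < side u z y}.
(* The hull is traversed clockwise. *)
Definition next_on_hull x w := [&& x \in X, w \in X, w != x &
  all (fun y => [|| y == x, y == w | orient x w y < 0]) X].

Lemma next_on_hullP x w : next_on_hull x w -> [/\ x \in X, w \in X, w != x &
  {in X, forall y, y != x -> y != w -> orient x w y < 0}].
Proof.
case/and4P => xX wX wx /allP h; split=> // y yX yx yw.
by have := h _ yX; rewrite (negPf yx) (negPf yw).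
Qed.

Lemma small_perturbation (T : eqType) (f g : T -> R) (s : seq T) :
  {in s, forall i, 0 < f i} -> exists2 e, 0 < e & {in s, forall i, 0 < f i + e * g i}.
Proof.
elim: s => [|i s IH] fs; first by exists 1; rewrite ?ltr01.
have [|e e0 He] := IH; first by move=> j js; apply: fs; rewrite inE js orbT.
have fi : 0 < f i by apply: fs; rewrite mem_head.
pose d := f i / (`|g i| + 1).
have n1 : 0 < `|g i| + 1 by rewrite ltr_wpDl.
have d0 : 0 < d by rewrite divr_gt0.
have dg : d * (`|g i| + 1) = f i by rewrite divfK ?gt_eqF.
have ok d' j : 0 < d' -> d' <= e -> 0 < f j -> 0 < f j + e * g j -> 0 < f j + d' * g j.
  by move=> p1 p2 p3 p4; have [g0|/ltW g0] := lerP 0 (g j); nra.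
exists (Num.min e d); first by rewrite lt_min e0.
have m0 : 0 < Num.min e d by rewrite lt_min e0.
move=> j; rewrite inE => /predU1P[->|js].
  have md : Num.min e d <= d by rewrite ge_min lexx orbT.
  have := ler_norm (- g i); rewrite normrN => ng.
  move: m0 md; move: (Num.min e d) => m m0 md; have := normr_ge0 (g i) => nn.
  have : m * (`|g i| + 1) <= f i by rewrite -dg ler_pM2r.
  by move: ng nn m0; clear; nra.
apply: ok => //; last exact: He; first by rewrite ge_min lexx.
by apply: fs; rewrite inE js orbT.
Qed.

(** Turning the line q z slightly around q makes z strictly positive as well, and the finitely many
    other points stay so. *)
Lemma supported_vertex u q z : z != q -> side u q z = 0 ->
  {in X, forall y, y != q -> y != z -> 0 < side u q y} -> hull_vertex q.
Proof.
move=> zq uz uX; pose e : pl := ((vec q z).2, - (vec q z).1).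
have ez : 0 < side e q z.
  have -> : side e q z = dot (vec q z) (vec q z) by rewrite /side /cross /dot /e /=; ring.
  rewrite /dot; case: (eqVneq z.1 q.1) => [z1|z1]; last first.
    by apply: ltr_pwDl; rewrite -expr2 ?exprn_even_gt0 //= ?subr_eq0 // sqr_ge0.
  have z2 : z.2 != q.2 by apply: contraNneq zq => z2; rewrite [z]surjective_pairing z1 z2 -surjective_pairing.
  by apply: ltr_wpDl; rewrite -expr2 ?exprn_even_gt0 //= ?subr_eq0 // sqr_ge0.
have [|h h0 Hh] := small_perturbation (f := side u q) (side e q)
    (s := [seq y <- X | (y != q) && (y != z)]).
  by move=> y; rewrite mem_filter => /andP[/andP[yq yz] yX]; apply: uX.
exists (u.1 + h * e.1, u.2 + h * e.2) => y yX yq.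
have -> : side (u.1 + h * e.1, u.2 + h * e.2) q y = side u q y + h * side e q y.
  by rewrite /side /cross /=; ring.
have [->|yz] := eqVneq y z; first by rewrite uz add0r mulr_gt0.
by apply: Hh; rewrite mem_filter yq yz.
Qed.

Lemma hull_edge_vertices x w : next_on_hull x w -> hull_vertex x /\ hull_vertex w.
Proof.
case/next_on_hullP => xX wX wx h; split.
  apply: (@supported_vertex (vec w x) _ w) => //; first by rewrite /side /cross /=; ring.
  by move=> y yX yx yw; have := h _ yX yx yw; rewrite /orient /side /cross /=; lra.
apply: (@supported_vertex (vec w x) _ x); rewrite 1?eq_sym //; first by rewrite /side /cross /=; ring.
by move=> y yX yw yx; have := h _ yX yx yw; rewrite /orient /side /cross /=; lra.
Qed.

Lemma hull_vertex_first v (L : seq pl) : hull_vertex v -> v \in X -> {subset L <= X} -> v \notin L ->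
  L != [::] -> exists2 m, m \in L & {in L, forall y, y != m -> orient v m y < 0}.
Proof.
move=> [u hu] vX LX vL Ln0.
have lu : {in L, forall y, 0 < cross u (vec v y)}.
  by move=> y yL; apply: hu; [exact: LX | apply: contraNneq vL => <-].
have [L' pL sL] := sort_directions lu.
case: L' pL sL => [|m L'] pL; first by move: (perm_size pL); case: (L) Ln0.
move=> /= /andP[/allP mL _]; exists m; first by rewrite -(perm_mem pL) mem_head.
move=> y yL ym; have yL' : y \in L'.
  by move: yL; rewrite -(perm_mem pL) inE (negPf ym).
have mL' : m \in L by rewrite -(perm_mem pL) mem_head.
rewrite lt_neqAle mL // andbT; apply: gpX => //; try exact: LX.
- by apply: contraNneq vL => ->.
- by rewrite eq_sym.
- by apply: contraNneq vL => ->.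
Qed.

Lemma hull_vertex_last v (L : seq pl) : hull_vertex v -> v \in X -> {subset L <= X} -> v \notin L ->
  L != [::] -> exists2 m, m \in L & {in L, forall y, y != m -> orient v y m < 0}.
Proof.
move=> [u hu] vX LX vL Ln0.
have lu : {in L, forall y, 0 < cross u (vec v y)}.
  by move=> y yL; apply: hu; [exact: LX | apply: contraNneq vL => <-].
have [L' pL sL] := sort_directions lu.
case/lastP: L' pL sL => [|L' m] pL; first by move: (perm_size pL); case: (L) Ln0.
rewrite pairwise_rcons => /andP[/allP mL _].
have mL' : m \in L by rewrite -(perm_mem pL) mem_rcons mem_head.
exists m => // y yL ym; have yL' : y \in L'.
  by move: yL; rewrite -(perm_mem pL) mem_rcons inE (negPf ym).
rewrite lt_neqAle mL // andbT; apply: gpX => //; try exact: LX.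
- by apply: contraNneq vL => ->.
- by apply: contraNneq vL => ->.
Qed.

Lemma hull_vertex_next z : z \in X -> (1 < size X)%N -> uniq X -> hull_vertex z ->
  exists w, next_on_hull z w.
Proof.
move=> zX sX uX hz.
have [|||m mL Hm] := hull_vertex_first (L := [seq y <- X | y != z]) hz zX.
- by move=> y; rewrite mem_filter => /andP[].
- by rewrite mem_filter eqxx.
- rewrite -size_eq0 size_filter -lt0n -(ltn_add2l (count (pred1 z) X)).
  by rewrite (count_predC (pred1 z)) count_uniq_mem // zX.
move: mL; rewrite mem_filter => /andP[mz mX]; exists m.
rewrite /next_on_hull zX mX mz /=; apply/allP => y yX.
case: (eqVneq y z) => //= yz; case: (eqVneq y m) => //= ym.
by apply: Hm => //; rewrite mem_filter yz.
Qed.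

Lemma orient_deg a b : (orient a a b = 0) * (orient a b a = 0) * (orient a b b = 0).
Proof. by rewrite /orient /cross /=; split; [split|]; ring. Qed.

(** The linear form [side u z] vanishes at z, yet there it is a barycentric combination, with
    weights of one sign, of its positive values at a, b, c. *)
Lemma hull_vertex_not_inside z a b c : hull_vertex z -> a \in X -> b \in X -> c \in X ->
  orient a b z < 0 -> orient b c z < 0 -> orient c a z < 0 -> False.
Proof.
move=> [u hu] aX bX cX ab bc ca.
have E : orient a b z * side u z c + orient b c z * side u z a + orient c a z * side u z b = 0.
  by rewrite /orient /side /cross /=; ring.
have az : a != z by apply: contraTneq ab => ->; rewrite orient_deg ltxx.
have bz : b != z by apply: contraTneq bc => ->; rewrite orient_deg ltxx.
have cz : c != z by apply: contraTneq ca => ->; rewrite orient_deg ltxx.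
have := hu _ aX az; have := hu _ bX bz; have := hu _ cX cz; clear -E ab bc ca; nra.
Qed.

Section Pencil.
Variable v : pl.
Hypotheses (vX : v \in X) (hv : hull_vertex v).
Definition below x y := orient v x y < 0.

Lemma below_neq x y : below x y -> [/\ x != v, y != v & x != y].
Proof.
by rewrite /below => h; split; apply: contraTneq h => ->; rewrite orient_deg ltxx.
Qed.

Lemma below_asym x y : below x y -> below y x = false.
Proof. by rewrite /below orient_swap oppr_lt0 => h; apply/negbTE; rewrite -leNgt ltW. Qed.

Lemma below_total x y : x \in X -> y \in X -> x != v -> y != v -> x != y ->
  below x y || below y x.
Proof.
move=> xX yX xv yv xy; have := gpX vX xX yX; rewrite !(eq_sym v) => /(_ xv xy yv).
by rewrite /below (orient_swap v y) oppr_lt0; case: ltgtP.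
Qed.

Lemma below_trans : {in X & &, transitive below}.
Proof.
move=> y x z yX xX zX xy yz; have [xv yv nxy] := below_neq xy.
have [_ zv nyz] := below_neq yz.
have xz : x != z by apply: contraTneq xy => ->; rewrite below_asym.
have [u hu] := hv.
rewrite /below lt_neqAle gpX // 1?eq_sym //=.
by apply: (cross_trans (hu x _ _) (hu y _ _) (hu z _ _)) => //; apply: ltW.
Qed.

Lemma next_below x w : next_on_hull x w -> x != v -> w != v -> below x w.
Proof.
case/next_on_hullP => _ _ _ h xv wv; rewrite /below orient_rot.
by apply: h => //; rewrite eq_sym.
Qed.

Lemma next_adjacent x w z : next_on_hull x w -> z \in X -> hull_vertex z ->
  below x z -> below z w -> False.
Proof.
move=> nxw zX hz xz zw; have [xX wX _ h] := next_on_hullP nxw.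
have [xv _ nxz] := below_neq xz; have [_ _ nzw] := below_neq zw.
apply: (hull_vertex_not_inside hz vX xX wX xz); last by rewrite orient_rot.
by apply: h => //; rewrite eq_sym.
Qed.

(** Otherwise z would be inside the triangle v p r. This supplies the side condition of
    [escaping_path] at an endpoint z. *)
Lemma hull_vertex_outer z p r : z \in X -> p \in X -> r \in X -> hull_vertex z ->
  below p z -> below z r -> 0 < orient p r z.
Proof.
move=> zX pX rX hz pz zr.
have [_ _ npz] := below_neq pz; have [_ _ nzr] := below_neq zr.
have npr : p != r by apply: contraTneq zr => <-; rewrite below_asym.
rewrite lt_neqAle eq_sym gpX // 1?eq_sym //= leNgt; apply/negP => h.
by apply: (hull_vertex_not_inside hz vX pX rX pz h); rewrite orient_rot.
Qed.

(** Walk along the hull from z1: each next vertex is higher and, by [next_adjacent], cannot jump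
    over z2, while the number of points above decreases. *)
Lemma hull_chain z1 z2 : uniq X -> z1 \in X -> z2 \in X -> hull_vertex z1 -> hull_vertex z2 ->
  below z1 z2 ->
  exists2 ch, path (fun x w => next_on_hull x w && below x w) z1 ch & last z1 ch = z2.
Proof.
move=> uX; have [n le_n] := ubnP (count (below z1) X).
elim: n => // n IH in z1 le_n * => z1X z2X h1 h2 b12.
have [z1v z2v n12] := below_neq b12.
have sX : (1 < size X)%N.
  rewrite ltnNge; apply: contraNN z1v => sX1; case: X sX1 vX z1X => [|x [|]] //= _.
  by rewrite !inE => /eqP-> /eqP->.
have [w nw] := hull_vertex_next z1X sX uX h1.
have [_ wX wz1 hw] := next_on_hullP nw.
(* Were v next after z1, every other point would be below z1, against [b12]. *)
have wv : w != v.
  apply: contraTneq (b12) => wv; rewrite below_asym //.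
  by rewrite /below -orient_rot -wv; apply: hw => //; rewrite ?wv // eq_sym.
have b1w := next_below nw z1v wv.
have [wz2|wz2] := eqVneq w z2; first by exists [:: w]; rewrite /= ?nw ?b1w.
have b2 : below w z2.
  by case/orP: (below_total wX z2X wv z2v wz2) => // h; case: (next_adjacent nw z2X h2 b12 h).
have [|ch pch lch] := IH w _ wX z2X (hull_edge_vertices nw).2 h2 b2.
  rewrite ltnS in le_n; apply: leq_trans le_n.
  rewrite -[count (below z1) X]size_filter -(count_predC (pred1 w)) !count_filter -add1n.
  apply: leq_add.
    by rewrite -has_count; apply/hasP; exists w => //=; rewrite eqxx.
  rewrite (eq_in_count (a1 := below w) (a2 := fun x => below w x && (below z1 x && (x != w)))).
    by apply: sub_count => x /= /andP[_ /andP[-> ->]].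
  move=> x xX /=; case wx: (below w x) => //=; have [_ _ nwx] := below_neq wx.
  by rewrite eq_sym nwx (below_trans _ _ _ b1w wx).
by exists (w :: ch); rewrite /= ?nw ?b1w.
Qed.

(** The points of L below q form an initial segment of the order around v, so their number
    determines them. This is why pigeonholes on counts suffice. *)
Lemma below_count_eq q q0 (L : seq pl) : {subset L <= X} -> v \notin L ->
  q \in X -> q0 \in X -> q != v -> q0 != v ->
  count (below^~ q) L = count (below^~ q0) L -> {in L, forall r, below r q = below r q0}.
Proof.
move=> LX vL qX q0X qv q0v.
wlog : q q0 qX q0X qv q0v / below q q0.
  move=> W; have [->//|nq] := eqVneq q q0.
  case/orP: (below_total qX q0X qv q0v nq) => h E r rL; first exact: W.
  by apply/esym; apply: W.
move=> qq0 E; apply: count_sub_eq => // r rL rq.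
by apply: (below_trans _ _ _ rq qq0) => //; apply: LX.
Qed.
End Pencil.
End Hull.

(** * Many levels: two paths and a chain of hull edges *)

Section Assembly.
Variable R : realFieldType.
Notation pl := (plane R).
Implicit Types (a b c p q r u v w x y z : pl) (t k : R) (E : seq (pl * pl)).
Variable X : seq pl.
Hypothesis gpX : gp (mem X).

Lemma side_vec v z y : side (vec z v) v y = orient v y z.
Proof. by rewrite /orient /side /cross /=; ring. Qed.

Lemma cross_vecC u v z : cross u (vec z v) = - side u v z.
Proof. by rewrite /side /cross /=; ring. Qed.

Lemma edges_cat_last a s1 s2 : edges a (s1 ++ s2) = edges a s1 ++ edges (last a s1) s2.
Proof. by elim: s1 a => [|c s1 IH] a //=; rewrite IH. Qed.

Lemma edges_path (e : rel pl) a s : path e a s -> {in edges a s, forall f, e f.1 f.2}.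
Proof.
elim: s a => [|c s IH] a //= /andP[ac pc] f; rewrite inE => /predU1P[->//|].
exact: IH.
Qed.

Lemma edges_mem a s f : f \in edges a s -> (f.1 \in belast a s) && (f.2 \in s).
Proof.
elim: s a => [|c s IH] a //=; rewrite !inE => /predU1P[->|/IH /andP[h1 h2]].
  by rewrite !eqxx.
by rewrite h1 h2 !orbT.
Qed.

Lemma on_edge_cat E1 E2 x : on_edge (E1 ++ E2) x <-> on_edge E1 x \/ on_edge E2 x.
Proof.
split=> [[e]|[[e eE ex]|[e eE ex]]]; last 2 first.
- by exists e; rewrite // mem_cat eE.
- by exists e; rewrite // mem_cat eE orbT.
by rewrite mem_cat => /orP[eE|eE] ex; [left|right]; exists e.
Qed.

Lemma on_edge_side u q E x : ends_in (fun z => 0 <= side u q z) E -> on_edge E x ->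
  0 <= side u q x.
Proof.
move=> hE [e eE [t t01 ->]]; rewrite side_mix; have [h1 h2] := hE _ eE.
exact: sum_pos_side.
Qed.

(** The ray stays strictly on the outer side of the supporting line at v. It is the front ray of the
    outermost constraints. *)
Lemma escapes_outside v u d E k : {in X, forall y, y != v -> 0 < side u v y} ->
  ends_in (fun z => z \in X) E -> cross u d < 0 -> 0 < k -> escapes (on_edge E) (ray v k d).
Proof.
move=> hu EX ud k0; apply: (@escapes_ray _ _ _ d).
  by apply: contraTneq ud => ->; rewrite /cross /= !mulr0 subrr ltxx.
move=> t t0; rewrite ray_ray => h.
have : 0 <= side u v (ray v (k + t) d).
  apply: on_edge_side h => e eE; have [e1 e2] := EX _ eE.
  by split; [have [->|n] := eqVneq e.1 v | have [->|n] := eqVneq e.2 v];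
    rewrite ?side0 // ltW ?hu.
by rewrite side_ray side0 add0r leNgt pmulr_rlt0 ?ud // ltr_wpDr.
Qed.

Lemma hull_edge_meets_ok x w e : next_on_hull X x w -> e.1 \in X -> e.2 \in X ->
  ~~ ((e.1 \in [:: x; w]) && (e.2 \in [:: x; w])) -> meets_ok (x, w) e.
Proof.
case/next_on_hullP => xX wX wx h e1X e2X ne y xwy ey.
have hs z : z \in X -> side (vec x w) x z = 0 /\ (z = x \/ z = w) \/ side (vec x w) x z < 0.
  move=> zX; have [->|zx] := eqVneq z x; first by left; rewrite side0; split=> //; left.
  have [->|zw] := eqVneq z w; first by left; split; [rewrite /side /cross /=; ring|right].
  by right; exact: h.
have y0 : side (vec x w) x y = 0.
  by case: xwy => t _ ->; rewrite /side /cross /=; ring.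
suff ye : y = e.1 \/ y = e.2.
  split=> //; apply: (on_seg_vertex gpX _ xX wX xwy).
  by case: ye => ->.
case: ey y0 => t /andP[t0 t1] ->; rewrite side_mix.
have mixl a b : mix 0 a b = a by rewrite /mix; case: (a) => *; congr pair => /=; ring.
have mixr a b : mix 1 a b = b by rewrite /mix; case: (b) => *; congr pair => /=; ring.
case: (hs _ e1X) (hs _ e2X) => [[e10 e1]|e1] [[e20 e2]|e2].
- by exfalso; move: ne; rewrite !inE; case: e1 e2 => -> [] ->; rewrite !eqxx ?orbT.
- rewrite e10 mulr0 add0r => /eqP; rewrite mulf_eq0 (lt_eqF e2) orbF => /eqP ->.
  by left.
- rewrite e20 mulr0 addr0 => /eqP; rewrite mulf_eq0 (lt_eqF e1) orbF subr_eq0 => /eqP <-.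
  by right.
- by move=> E; exfalso; move: t0 t1 e1 e2 E; clear; nra.
Qed.

Variables blue red : seq pl.

Definition excluding_polygon := exists x0 s, [/\ perm_eq (x0 :: s) blue,
  simple (edges x0 (rcons s x0)) &
  {in red, forall r, escapes (on_edge (edges x0 (rcons s x0))) r}].

Hypotheses (uX : uniq X) (blueX : {subset blue <= X}) (redX : {subset red <= X}).
Hypotheses (ublue : uniq blue) (ured : uniq red) (disj : {in red, forall r, r \notin blue}).
Hypothesis hull_blue : forall z, z \in X -> hull_vertex X z -> z \in blue.

Lemma hull_chain_mem v z ch : v \in X -> hull_vertex X v -> z \in X -> z != v ->
  hull_vertex X z ->
  path (fun x w => next_on_hull X x w && below v x w) z ch ->
  uniq (z :: ch) /\
  {in z :: ch, forall x, [/\ x \in X, hull_vertex X x, x != v,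
     x = z \/ below v z x & x = last z ch \/ below v x (last z ch)]}.
Proof.
move=> vX hv; elim: ch z => [|w ch IH] z zX zv hz /=.
  by move=> _; split=> // x; rewrite inE => /eqP ->; split=> //; left.
case/andP => /andP[nzw bzw] pw; have [_ wX _ _] := next_on_hullP nzw.
have [_ wv _] := below_neq bzw.
have [uw {}IH] := IH w wX wv (hull_edge_vertices nzw).2 pw.
have bz x : x \in w :: ch -> below v z x.
  move=> xw; have [xX _ _ [->//|bwx] _] := IH _ xw.
  by apply: (below_trans gpX vX hv) bwx.
have zw : z \notin w :: ch.
  by apply/negP => /bz; rewrite /below orient_deg ltxx.
split; first by rewrite zw.
move=> x; rewrite inE => /predU1P[->|xw]; last first.
  by have [xX hx xv _ xl] := IH _ xw; split=> //; right; exact: bz.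
by split=> //; [left | right; apply: bz; exact: mem_last].
Qed.

Lemma two_sided_polygon v z1 z2 (Q : seq pl) :
  v \in X -> hull_vertex X v -> z1 \in X -> hull_vertex X z1 -> z2 \in X -> hull_vertex X z2 ->
  below v z1 z2 -> uniq Q -> {subset Q <= blue} -> {in Q, forall q, ~ hull_vertex X q} ->
  {in Q, forall q, below v z1 q /\ below v q z2} ->
  {in red, forall r, below v r z1 /\ {in Q, forall q, below v r q} \/
                     below v z2 r /\ {in Q, forall q, below v q r}} ->
  (6 * size red + 1 <= size Q)%N -> excluding_polygon.
Proof.
move=> vX hv z1X h1 z2X h2 b12 uQ Qb Qh Qz redQ szQ.
have [z1v z2v n12] := below_neq b12.
have [u hu] := hv; have [u1 hu1] := h1.
have QX : {subset Q <= X} by move=> q /Qb /blueX.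
have Qv : {in Q, forall q, q != v} by move=> q /Qz[/below_neq[]].
(* In the order around v, the first 3 l points serve the lower path, the next one, [c], gives the
   separating line, and at least 3 l serve the upper path: hence 6 l + 1. *)
have [|L pL sL] := sort_directions (L := Q) (g := vec v) (n := u).
  by move=> q qQ; apply: hu; [exact: QX | exact: Qv].
have szL : (3 * size red < size L)%N by rewrite (perm_size pL); move: szQ; move: (size red) (size Q); clear; lia.
have EL := cat_take_drop (3 * size red) L.
have sz1 : size (take (3 * size red) L) = (3 * size red)%N by rewrite size_take szL.
have sz2 : size (drop (3 * size red) L) = (size Q - 3 * size red)%N.
  by rewrite size_drop (perm_size pL).
move: EL sz1 sz2; set l1 := take _ _; case: (drop _ _) => [|c l2].
  by move=> _ _ /=; move: szQ; move: (size red) (size Q); clear; lia.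
move=> EL sz1 sz2.
have memQ q : (q \in Q) = (q \in l1) || (q == c) || (q \in l2).
  by rewrite -(perm_mem pL) -EL mem_cat inE orbA.
have uL : uniq (l1 ++ c :: l2) by rewrite EL (perm_uniq pL).
move: uL; rewrite cat_uniq /= negb_or => /and3P[ul1 /andP[cl1 dl] /andP[cl2 ul2]].
have cQ : c \in Q by rewrite memQ eqxx orbT.
have l1Q q : q \in l1 -> q \in Q by rewrite memQ => ->.
have l2Q q : q \in l2 -> q \in Q by rewrite memQ => ->; rewrite orbT.
move: sL; rewrite -EL pairwise_cat pairwise_cons allrel_consr.
move=> /and4P[/andP[/allP l1c _] _ /allP cl _].
have gpne q : q \in Q -> q != c -> orient v q c != 0 /\ orient v c q != 0.
  move=> qQ qc; have := gpX vX (QX _ qQ) (QX _ cQ); rewrite !(eq_sym v) !Qv // qc.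
  by move=> /(_ isT isT isT) n0; rewrite n0 orient_swap oppr_eq0.
have l1below q : q \in l1 -> below v q c.
  move=> ql; have qc : q != c by apply: contraNneq cl1 => <-.
  by rewrite /below lt_neqAle l1c // andbT; have [] := gpne _ (l1Q _ ql) qc.
have l2above q : q \in l2 -> below v c q.
  move=> ql; have qc : q != c by apply: contraNneq cl2 => <-.
  by rewrite /below lt_neqAle cl // andbT; have [] := gpne _ (l2Q _ ql) qc.
have [ch pch lch] := hull_chain gpX vX hv uX z1X z2X h1 h2 b12.
have [uch chP] := hull_chain_mem vX hv z1X z1v h1 pch.
rewrite lch in chP.
have trans := below_trans gpX vX hv.
have [c1 c2] := Qz _ cQ; have cX := QX _ cQ.
have vch : v \notin z1 :: ch by apply/negP => /chP[]; rewrite eqxx.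
have z2ch : z2 \in z1 :: ch by rewrite -lch mem_last.
have z1ch : z1 \in z1 :: ch by rewrite mem_head.
have Qch q : q \in Q -> q \notin z1 :: ch by move=> qQ; apply/negP => /chP[_ hq]; case: (Qh _ qQ).
(* All blue points off the chain, hull vertices included, are shared out by the line v c. *)
pose SU := [seq x <- blue | [&& x \notin z1 :: ch, x != v & ~~ below v x c]].
pose SL := [seq x <- blue | [&& x \notin z1 :: ch, x != v & below v x c]].
have SUP x : x \in SU -> [/\ x \in blue, x \notin z1 :: ch, x != v & ~~ below v x c].
  by rewrite mem_filter => /andP[/and3P[]].
have SLP x : x \in SL -> [/\ x \in blue, x \notin z1 :: ch, x != v & below v x c].
  by rewrite mem_filter => /andP[/and3P[]].
have SUX : {subset SU <= X} by move=> x /SUP[/blueX].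
have SLX : {subset SL <= X} by move=> x /SLP[/blueX].
pose RU := [seq r <- red | below v z2 r]; pose RL := [seq r <- red | below v r z1].
have RUP r : r \in RU -> [/\ r \in red, below v z2 r & {in Q, forall q, below v q r}].
  rewrite mem_filter => /andP[b2r rr]; split=> //; case: (redQ _ rr) => -[] // br1.
  by have := trans _ _ _ z1X (redX rr) z2X br1 b12; rewrite (below_asym b2r).
have RLP r : r \in RL -> [/\ r \in red, below v r z1 & {in Q, forall q, below v r q}].
  rewrite mem_filter => /andP[br1 rr]; split=> //; case: (redQ _ rr) => -[] // b2r.
  by have := trans _ _ _ z1X (redX rr) z2X br1 b12; rewrite (below_asym b2r).
have RUX : {subset RU <= X} by move=> r /RUP[/redX].
have RLX : {subset RL <= X} by move=> r /RLP[/redX].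
have szRU : (size RU <= size red)%N by rewrite size_filter count_size.
have szRL : (size RL <= size red)%N by rewrite size_filter count_size.
have [sU [pU smU escU]] : exists s, [/\ perm_eq s SU, simple (edges z2 (rcons s v)) &
    escaping l2 RU (edges z2 (rcons s v))].
  apply: (@escaping_path _ _ gpX (size RU).+1 z2 v u) => //.
  - by rewrite filter_uniq.
  - move=> q ql; rewrite mem_filter Qch ?l2Q //= Qv ?l2Q //= Qb ?l2Q // andbT.
    by rewrite below_asym ?l2above.
  - by rewrite filter_uniq.
  - by apply/negP => /SUP[_]; rewrite z2ch.
  - by apply/negP => /SUP[]; rewrite eqxx.
  - by move=> r /RUP[rr _ _]; apply/negP => /SUP[]; rewrite (negPf (disj rr)).
  - move=> q r ql /RUP[rr b2r _]; have [_ bq2] := Qz _ (l2Q _ ql).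
    by apply: (hull_vertex_outer gpX vX z2X (QX _ (l2Q _ ql)) (redX rr)).
  - by move=> q r ql /RUP[_ _ /(_ _ (l2Q _ ql))]; rewrite /below orient_rot.
  - by move=> q ql; apply: hu; [rewrite QX ?l2Q | rewrite Qv ?l2Q].
  - by move: szRU szQ sz2 => /=; move: (size red) (size Q) (size RU) (size l2); clear; lia.
have [sL' [pL' smL escL]] : exists s, [/\ perm_eq s SL, simple (edges v (rcons s z1)) &
    escaping l1 RL (edges v (rcons s z1))].
  apply: (@escaping_path _ _ gpX (size RL).+1 v z1 u1) => //.
  - by rewrite eq_sym.
  - by rewrite filter_uniq.
  - by move=> q ql; rewrite mem_filter Qch ?l1Q //= Qv ?l1Q //= Qb ?l1Q // andbT l1below.
  - by rewrite filter_uniq.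
  - by apply/negP => /SLP[]; rewrite eqxx.
  - by apply/negP => /SLP[_]; rewrite z1ch.
  - by move=> r /RLP[rr _ _]; apply/negP => /SLP[]; rewrite (negPf (disj rr)).
  - move=> q r ql /RLP[_ _ /(_ _ (l1Q _ ql))].
    by rewrite /below orient_swap oppr_lt0 orient_rot.
  - move=> q r ql /RLP[rr br1 _]; have [b1q _] := Qz _ (l1Q _ ql).
    have := hull_vertex_outer gpX vX z1X (redX rr) (QX _ (l1Q _ ql)) h1 br1 b1q.
    have -> : orient q r z1 = - orient r q z1 by rewrite /orient /cross /=; ring.
    by rewrite oppr_lt0.
  - by move=> q ql; apply: hu1; [rewrite QX ?l1Q | have [/below_neq[_ _]] := Qz _ (l1Q _ ql); rewrite eq_sym].
  - by move: szRL szQ sz1 => /=; move: (size red) (size Q) (size RL) (size l1); clear; lia.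
have memU x : x \in sU -> [/\ x \in blue, x \notin z1 :: ch, x != v & ~~ below v x c].
  by rewrite (perm_mem pU) => /SUP.
have memL x : x \in sL' -> [/\ x \in blue, x \notin z1 :: ch, x != v & below v x c].
  by rewrite (perm_mem pL') => /SLP.
have vb : v \in blue by apply: hull_blue.
exists z1, (ch ++ sU ++ v :: sL').
have -> : edges z1 (rcons (ch ++ sU ++ v :: sL') z1) =
    edges z1 ch ++ (edges z2 (rcons sU v) ++ edges v (rcons sL' z1)).
  by rewrite !rcons_cat rcons_cons edges_cat_last lch -cat_rcons edges_cat.
set EC := edges z1 ch; set EU := edges z2 _; set EL' := edges v _.
have leftU x : x \in rcons sU v -> x \notin z1 :: ch.
  by rewrite mem_rcons inE => /predU1P[->|/memU[]].
have leftL x : x \in v :: sL' -> x \notin z1 :: ch.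
  by rewrite inE => /predU1P[->|/memL[]].
have ECX : ends_in (fun z => z \in X) EC.
  by apply: edges_ends => // x xch; have [] := chP x; rewrite // inE xch orbT.
have EUX : ends_in (fun z => z \in X) EU.
  by apply: edges_ends => // x; rewrite mem_rcons inE => /predU1P[->//|/memU[/blueX]].
have ELX : ends_in (fun z => z \in X) EL'.
  by apply: edges_ends => // x; rewrite mem_rcons inE => /predU1P[->//|/memL[/blueX]].
have ECmem e : e \in EC -> [/\ next_on_hull X e.1 e.2, below v e.1 e.2,
     e.1 \in z1 :: ch & e.2 \in z1 :: ch].
  move=> eE; have /andP[n b] := edges_path pch eE; split=> //; have /andP[m1 m2] := edges_mem eE.
    exact: mem_belast.
  by rewrite inE m2 orbT.
have chpair e y : e \in EC -> y \in [:: e.1; e.2] -> y \in z1 :: ch.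
  by move=> /ECmem[_ _ m1 m2]; rewrite !inE => /orP[]/eqP->; rewrite -in_cons.
have nCU : noncross EC EU.
  move=> e e' eE e'E; have [n _ _ _] := ECmem _ eE; have [e1 e2] := EUX _ e'E.
  rewrite (surjective_pairing e); apply: hull_edge_meets_ok => //.
  apply/negP => /andP[_ /(chpair _ _ eE)]; apply/negP/leftU.
  by have /andP[] := edges_mem e'E.
have nCL : noncross EC EL'.
  move=> e e' eE e'E; have [n _ _ _] := ECmem _ eE; have [e1 e2] := ELX _ e'E.
  rewrite (surjective_pairing e); apply: hull_edge_meets_ok => //.
  apply/negP => /andP[/(chpair _ _ eE) + _]; apply/negP/leftL.
  by have /andP[] := edges_mem e'E; rewrite belast_rcons.
have sC : simple EC.
  move=> e e' eE e'E ne; have [n b _ _] := ECmem _ eE; have [_ b' _ _] := ECmem _ e'E.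
  have [e1 e2] := ECX _ e'E.
  rewrite (surjective_pairing e); apply: hull_edge_meets_ok => //.
  apply/negP; move: ne; rewrite -pair_eqE /= !inE !(eq_sym e.1) !(eq_sym e.2).
  have [_ _ n'] := below_neq b'.
  case: (eqVneq e'.1 e.1) => [E1|_] /=.
    by rewrite -E1 (eq_sym e'.2 e'.1) (negPf n') /= => /negPf ->.
  case: (eqVneq e'.1 e.2) => [E1|_] //= _; case: (eqVneq e'.2 e.1) => [E2|_] /=.
    by move: b'; rewrite E1 E2 below_asym.
  by rewrite -E1 (eq_sym e'.2 e'.1) (negPf n').
have abovec x : x \in X -> x != v -> ~~ below v x c -> 0 <= side (vec c v) v x.
  move=> xX xv nb; rewrite side_vec.
  by rewrite leNgt.
have belowc x : below v x c -> side (vec c v) v x < 0.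
  by rewrite side_vec.
have nUL : noncross EU EL'.
  apply: (@noncross_sep _ _ gpX (vec c v) v v) => //; last exact: side0.
    apply: edges_ends; first by split=> //; apply: abovec => //; rewrite below_asym.
    move=> x; rewrite mem_rcons inE => /predU1P[->|/memU[xb _ xv xc]].
      by rewrite side0.
    by split; [exact: blueX | apply: abovec => //; exact: blueX].
  apply: edges_ends; first by split=> //; right.
  move=> x; rewrite mem_rcons inE => /predU1P[->|/memL[xb _ xv xc]].
    by split=> //; left; exact: belowc.
  by split; [exact: blueX | left; exact: belowc].
have allX : ends_in (fun z => z \in X) (EC ++ (EU ++ EL')).
  by move=> e; rewrite !mem_cat => /or3P[/ECX|/EUX|/ELX].
split.
- apply: uniq_perm => //.
    rewrite -cat_cons !cat_uniq uch /= (perm_uniq pU) (perm_uniq pL') !filter_uniq // andbT.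
    apply/andP; split; first by apply/hasPn => x; rewrite mem_cat inE => /or3P[/memU[]|/eqP->|/memL[]].
    rewrite negb_or /= -andbA; apply/and3P; split; first by apply/negP => /memU[]; rewrite eqxx.
      by apply/hasPn => x /memL[_ _ _ xc]; apply/negP => /memU[_ _ _]; rewrite xc.
    by apply/negP => /memL[]; rewrite eqxx.
  move=> x; rewrite -cat_cons !mem_cat [x \in v :: _]inE (perm_mem pU) (perm_mem pL') !mem_filter.
  case xch: (x \in z1 :: ch) => /=.
    by have [xX hx _ _ _] := chP _ xch; rewrite hull_blue.
  case: (eqVneq x v) => [->|xv] /=; first by rewrite vb.
  by case: (below v x c); rewrite ?orbF.
- by apply: simple_cat => //; [apply: simple_cat | move=> e e' eE; rewrite mem_cat => /orP[]; [apply: nCU|apply: nCL]].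
have sd1 y : y = z1 \/ y = v \/ below v z1 y -> 0 <= side (vec z1 v) v y.
  by case=> [->|[->|]]; rewrite ?side0 //; rewrite side_vec ?orient_deg // /below orient_swap oppr_lt0 => /ltW.
have sd2 y : y = z2 \/ y = v \/ below v y z2 -> 0 <= side (vec v z2) v y.
  have -> : side (vec v z2) v y = - orient v y z2 by rewrite orient_swap opprK.
  by case=> [->|[->|/ltW]]; rewrite ?orient_deg ?oppr0 // oppr_ge0.
move=> r rr; have rX := redX rr.
case: (redQ _ rr) => -[br _].
(* Beyond the line v z1 the polygon consists of the path from v to z1 only. The front ray of this
   line starts at v and leaves the hull there. *)
- apply: (escL _ [:: (v, vec z1 v, 1)]); last 2 first.
  + by move=> r' /RLP[_ br' _] /=; rewrite andbT /cside mul1r side_vec.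
  + by rewrite mem_filter br.
  + split=> // k k0 _; apply: (escapes_outside hu allX) => //=.
    by rewrite cross_vecC oppr_lt0 hu.
  + move=> d q; rewrite inE => /eqP -> ql r' /RLP[_ _ /(_ _ (l1Q _ ql))] /=.
    by rewrite /below mul1r orient_swap oppr_lt0 orient_rot.
  move=> x /=; rewrite andbT /cside /= mul1r => xr /on_edge_cat[h|/on_edge_cat[h|//]]; exfalso.
    have : 0 <= side (vec z1 v) v x; last by rewrite leNgt xr.
    apply: on_edge_side h; apply: edges_ends; first by apply: sd1; left.
    move=> y ych; apply: sd1; have [_ _ _ [] h' _] := chP y (mem_behead (s := z1 :: ch) ych); [by left|by right; right].
  have : 0 <= side (vec z1 v) v x; last by rewrite leNgt xr.
  apply: on_edge_side h; apply: edges_ends; first by apply: sd1; right; right.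
  move=> y; rewrite mem_rcons inE => /predU1P[->|/memU[yb _ yv yc]]; apply: sd1.
    by right; left.
  right; right; have [->//|nyc] := eqVneq y c.
  have := below_total gpX vX (blueX yb) cX yv (Qv _ cQ) nyc; rewrite (negPf yc) /= => cy.
  exact: (trans _ _ _ cX z1X (blueX yb) c1 cy).
- apply: (escU _ [:: (v, vec z2 v, -1)]); last 2 first.
  + by move=> r' /RUP[_ br' _] /=; rewrite andbT /cside mulN1r side_vec -orient_swap.
  + by rewrite mem_filter br.
  + split=> // k k0 _; apply: (escapes_outside hu allX) => //=.
    by rewrite cross_vecC oppr_lt0 hu.
  + move=> d q; rewrite inE => /eqP -> ql r' /RUP[_ _ /(_ _ (l2Q _ ql))] /=.
    by rewrite /below mulN1r oppr_gt0 orient_rot.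
  move=> x /=; rewrite andbT /cside /= => xr /on_edge_cat[h|/on_edge_cat[//|h]]; exfalso.
    have : 0 <= side (vec v z2) v x; last first.
    by move: xr; rewrite mulN1r side_vec -orient_swap leNgt => ->.
    apply: on_edge_side h; apply: edges_ends; first by apply: sd2; right; right.
    move=> y ych; apply: sd2; have [_ _ _ _ [] h'] := chP y (mem_behead (s := z1 :: ch) ych); [by left|by right; right].
  have : 0 <= side (vec v z2) v x; last first.
    by move: xr; rewrite mulN1r side_vec -orient_swap leNgt => ->.
  apply: on_edge_side h; apply: edges_ends; first by apply: sd2; right; left.
  move=> y; rewrite mem_rcons inE => /predU1P[->|/memL[yb _ yv yc]]; apply: sd2; right; right => //.
  exact: (trans _ _ _ cX (blueX yb) z2X yc c2).
Qed.
End Assembly.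

(** * One level: three paths in a triangle *)

Section Fan.
Variable R : realFieldType.
Notation pl := (plane R).
Implicit Types (p q r u v w x y z A B C : pl) (t k : R) (E : seq (pl * pl)).
Variable X : seq pl.
Hypothesis gpX : gp (mem X).
Variables blue red : seq pl.
Hypotheses (blueX : {subset blue <= X}) (redX : {subset red <= X}).
Hypotheses (ublue : uniq blue) (ured : uniq red) (disj : {in red, forall r, r \notin blue}).

Definition fan_dir A B C kB kC : pl :=
  (kB * (C.1 - A.1) + kC * (B.1 - A.1), kB * (C.2 - A.2) + kC * (B.2 - A.2)).
(* Up to a factor, [- orient C A x] and [- orient A B x] are the barycentric
   coordinates of x at B and C; [fan] is their weighted difference, which
   vanishes on a line through A. The three such lines of a weighted triangle
   meet and cut the plane into three sectors. *)
Definition fan A B C kB kC x := kC * orient A B x - kB * orient C A x.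

Lemma fanE A B C kB kC x : fan A B C kB kC x = side (fan_dir A B C kB kC) A x.
Proof. by rewrite /fan /fan_dir /side /orient /cross /=; ring. Qed.

Lemma fan_neg_side A B C kB kC x :
  side (- (fan_dir A B C kB kC).1, - (fan_dir A B C kB kC).2) A x = - fan A B C kB kC x.
Proof. by rewrite fanE /side /cross /=; ring. Qed.

Lemma fan_at A B C kB kC : fan A B C kB kC A = 0.
Proof. by rewrite fanE side0. Qed.

Lemma fan_next A B C kB kC : fan A B C kB kC B = kB * - orient A B C.
Proof. by rewrite /fan /orient /cross /=; ring. Qed.

Lemma fan_prev A B C kB kC : fan A B C kB kC C = kC * orient A B C.
Proof. by rewrite /fan /orient /cross /=; ring. Qed.

Lemma fan_sum A B C kA kB kC x :
  fan A B C kB kC x + fan B C A kC kA x + fan C A B kA kB x = 0.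
Proof. by rewrite /fan; ring. Qed.

Definition same_side A (P : seq pl) :=
  {in P &, forall p q, {in red, forall r, below A r p = below A r q}}.

Lemma orient_distinct A B C : orient A B C < 0 -> [/\ A != B, B != C & A != C].
Proof. by move=> h; split; apply: contraTneq h => ->; rewrite orient_deg ltxx. Qed.

(** No red point is seen from A between two points of P. So p can be replaced by whichever of [p1],
    [p2] is across the cevian from r, and then the cevian settles the sign. *)
Lemma fan_sign A B C kB kC (P : seq pl) p1 p2 : A \in X -> B \in X -> C \in X ->
  hull_vertex X A -> orient A B C < 0 -> 0 < kB -> 0 < kC ->
  {subset P <= blue} -> A \notin P -> A \notin red -> same_side A P ->
  p1 \in P -> p2 \in P -> 0 < fan A B C kB kC p1 -> fan A B C kB kC p2 < 0 ->
  {in P & red, forall p r,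
    (0 < fan A B C kB kC r -> 0 < orient p r A) /\ (fan A B C kB kC r < 0 -> orient p r A < 0)}.
Proof.
move=> AX BX CX [h hh] ABC kB0 kC0 Pb AP Ared sP p1P p2P; set u := fan_dir A B C kB kC.
rewrite !fanE -/u => f1 f2 p r pP rr; rewrite -orient_rot fanE -/u.
have [AB BC AC] := orient_distinct ABC.
have hu : 0 < cross h u.
  have -> : cross h u = kB * side h A C + kC * side h A B.
    by rewrite /u /fan_dir /side /cross /=; ring.
  by apply: addr_gt0; apply: mulr_gt0 => //; apply: hh => //; rewrite eq_sym.
have PX q : q \in P -> q \in X by move=> /Pb /blueX.
have hP q : q \in P -> 0 < cross h (vec A q).
  by move=> qP; apply: hh; [exact: PX | apply: contraNneq AP => <-].
have rA : r != A by apply: contraNneq Ared => <-.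
have hr : 0 < cross h (vec A r) by apply: hh => //; exact: redX.
have gpP q : q \in P -> orient A q r != 0 /\ orient A r q != 0.
  move=> qP; have qr : q != r by apply: contraTneq (Pb _ qP) => ->; exact: disj.
  have Aq : A != q by apply: contraNneq AP => ->.
  by have qX := PX _ qP; have rX := redX rr; split; apply: gpX => //; rewrite eq_sym.
have [n1 n2] := gpP _ pP; split=> fr.
- rewrite orient_swap oppr_gt0 -/(below A r p) (sP _ _ pP p2P _ rr).
  rewrite /below lt_neqAle (gpP _ p2P).2 /=.
  apply: (cross_trans hr hu (hP _ p2P)); last exact: ltW.
  by rewrite crossC oppr_le0 ltW.
rewrite ltNge le_eqVlt eq_sym (negPf n1) /= orient_swap oppr_gt0 -/(below A r p).
rewrite (sP _ _ pP p1P _ rr) /below -leNgt orient_swap oppr_ge0.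
apply: (cross_trans (hP _ p1P) hu hr); last exact: ltW.
by rewrite crossC oppr_le0 ltW.
Qed.

(** [fan_sign] at A and at B gives the two sign conditions of [escaping_path]; it needs points of P
    across each cevian, which the other sectors provide. *)
Lemma fan_path A B C kA kB kC (P : seq pl) : A \in X -> B \in X -> C \in X ->
  hull_vertex X A -> hull_vertex X B -> orient A B C < 0 -> 0 < kA -> 0 < kB -> 0 < kC ->
  uniq P -> {subset P <= blue} -> A \in blue -> B \in blue -> 
  {in P, forall p, [/\ p != A, p != B & p != C]} ->
  {in P, forall p, orient A B p < 0} ->
  same_side A P -> same_side B P ->
  let FA := fan A B C kB kC in let FB := fan B C A kC kA in
  (0 < size red)%N ->
  (exists2 p, p \in P & FA p < 0) -> (exists2 p, p \in P & 0 < FB p) ->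
  (3 * size red <= size [seq p <- P | ((0 < FA p) && (FB p < 0))%R])%N ->
  exists s, [/\ perm_eq s [seq x <- blue | (x \notin [:: A; B; C]) && ((0 < FA x) && (FB x < 0)%R)],
    simple (edges A (rcons s B)) &
    forall E, ends_in (fun z => z \in X) E ->
      (forall x, 0 < FA x -> FB x < 0 -> on_edge E x -> on_edge (edges A (rcons s B)) x) ->
      {in red, forall r, 0 < FA r -> FB r < 0 -> escapes (on_edge E) r}].
Proof.
move=> AX BX CX hA hB ABC kA0 kB0 kC0 uP Pb Ab Bb Pn PAB sA sB FA FB red0.
case=> pa paP fa [pb pbP fb] szP.
have [AB BC AC] := orient_distinct ABC.
set P' := [seq p <- P | _] in szP *; set S := [seq x <- blue | _].
have [p0 p0P] : exists p0, p0 \in P'.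
  by case: (P') szP => [|p0 s] /=; [move: red0; clear; lia | exists p0; rewrite mem_head].
move: (p0P); rewrite mem_filter => /andP[/andP[p0A p0B] p0P0].
pose RS := [seq r <- red | (0 < FA r) && (FB r < 0)%R].
have P'P p : p \in P' -> [/\ p \in P, 0 < FA p & FB p < 0].
  by rewrite mem_filter => /andP[/andP[]].
have RSP r : r \in RS -> [/\ r \in red, 0 < FA r & FB r < 0].
  by rewrite mem_filter => /andP[/andP[]].
have AP : A \notin P by apply/negP => /Pn[]; rewrite eqxx.
have BP : B \notin P by apply/negP => /Pn[_]; rewrite eqxx.
have Ar : A \notin red by apply/negP => /disj; rewrite Ab.
have Br : B \notin red by apply/negP => /disj; rewrite Bb.
have sgA := fan_sign AX BX CX hA ABC kB0 kC0 Pb AP Ar sA p0P0 paP p0A fa.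
have BCA : orient B C A < 0 by rewrite -orient_rot.
have sgB := fan_sign BX CX AX hB BCA kC0 kA0 Pb BP Br sB pbP p0P0 fb p0B.
have oA : {in P' & RS, forall p r, 0 < orient p r A}.
  by move=> p r /P'P[pP _ _] /RSP[rr rA _]; apply: (sgA _ _ pP rr).1.
have oB : {in P' & RS, forall p r, orient p r B < 0}.
  by move=> p r /P'P[pP _ _] /RSP[rr _ rB]; apply: (sgB _ _ pP rr).2.
have [s [ps sm esc]] : exists s, [/\ perm_eq s S, simple (edges A (rcons s B)) &
    escaping P' RS (edges A (rcons s B))].
  apply: (@escaping_path _ _ gpX (size RS).+1 A B (vec B A)) => //.
  - by move=> x; rewrite mem_filter => /andP[_ /blueX].
  - by move=> r /RSP[/redX].
  - by rewrite filter_uniq.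
  - by rewrite filter_uniq.
  - move=> p pP'; have [pP fA fB] := P'P _ pP'; have [pA pB pC] := Pn _ pP.
    by rewrite mem_filter !inE (negPf pA) (negPf pB) (negPf pC) fA fB Pb.
  - by rewrite filter_uniq.
  - by rewrite mem_filter !inE eqxx.
  - by rewrite mem_filter !inE eqxx orbT.
  - by move=> r /RSP[rr _ _]; rewrite mem_filter (negPf (disj rr)) andbF.
  - move=> p /P'P[pP _ _]; have -> : side (vec B A) B p = - orient A B p.
      by rewrite /side /orient /cross /=; ring.
    by rewrite oppr_gt0 PAB.
  - apply: leq_trans (_ : 3 * size red <= _)%N; first by rewrite leq_mul2l size_filter count_size.
    by apply: leq_trans szP _; rewrite leq_addr.
exists s; split=> // E EX onE r rr rA rB.
have [h hh] := hA; have [h' hh'] := hB.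
(* The cevians are directed away from the triangle, so that their front rays leave the hull at A and
   B; the region is the sector between them. *)
pose uA : pl := (- (fan_dir A B C kB kC).1, - (fan_dir A B C kB kC).2).
pose uB : pl := (- (fan_dir B C A kC kA).1, - (fan_dir B C A kC kA).2).
have rE x : region [:: (A, uA, 1); (B, uB, -1)] x = (0 < FA x) && (FB x < 0)%R.
  by rewrite /= andbT /cside /= mul1r mulN1r /uA /uB !fan_neg_side oppr_lt0 opprK.
apply: (esc _ [:: (A, uA, 1); (B, uB, -1)]).
- split; first split=> //.
    move=> k k0 _; apply: (escapes_outside hh' EX) => //=.
    have -> : cross h' uB = - (kC * side h' B A + kA * side h' B C).
      by rewrite /uB /fan_dir /side /cross /=; ring.
    by rewrite oppr_lt0; apply: addr_gt0; apply: mulr_gt0 => //; apply: hh' => //; rewrite eq_sym.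
  move=> k k0 _; apply: (escapes_outside hh EX) => //=.
  have -> : cross h uA = - (kB * side h A C + kC * side h A B).
    by rewrite /uA /fan_dir /side /cross /=; ring.
  by rewrite oppr_lt0; apply: addr_gt0; apply: mulr_gt0 => //; apply: hh => //; rewrite eq_sym.
- move=> c p; rewrite !inE => /orP[]/eqP-> pP r' r'R /=.
    by rewrite mul1r oA.
  by rewrite mulN1r oppr_gt0 oB.
- by move=> x; rewrite rE => /andP[xA xB]; apply: onE.
- by move=> r' /RSP[_ ? ?]; rewrite rE; apply/andP.
- by rewrite mem_filter rA rB.
Qed.

(** Off A, B, C the three forms are non-zero and sum to zero, so going round there is exactly one
    step from positive to negative. This assigns every other blue or red point to one sector. *)
Lemma fan_polygon A B C kA kB kC (P : seq pl) :
  A \in X -> B \in X -> C \in X ->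
  hull_vertex X A -> hull_vertex X B -> hull_vertex X C -> orient A B C < 0 ->
  0 < kA -> 0 < kB -> 0 < kC ->
  uniq P -> {subset P <= blue} -> A \in blue -> B \in blue -> C \in blue ->
  {in P, forall p, [/\ orient A B p < 0, orient B C p < 0 & orient C A p < 0]} ->
  same_side A P -> same_side B P -> same_side C P ->
  let FA := fan A B C kB kC in let FB := fan B C A kC kA in let FC := fan C A B kA kB in
  {in X, forall x, [/\ x != A -> FA x != 0, x != B -> FB x != 0 & x != C -> FC x != 0]} ->
  (0 < size red)%N ->
  (3 * size red <= size [seq p <- P | ((0 < FA p) && (FB p < 0))%R])%N ->
  (3 * size red <= size [seq p <- P | ((0 < FB p) && (FC p < 0))%R])%N ->
  (3 * size red <= size [seq p <- P | ((0 < FC p) && (FA p < 0))%R])%N ->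
  excluding_polygon blue red.
Proof.
move=> AX BX CX hA hB hC ABC kA0 kB0 kC0 uP Pb Ab Bb Cb Pin sA sB sC FA FB FC gen red0 zAB zBC zCA.
have [AB BC AC] := orient_distinct ABC.
have BCA : orient B C A < 0 by rewrite -orient_rot.
have CAB : orient C A B < 0 by rewrite -orient_rot.
have Pn : {in P, forall p, [/\ p != A, p != B & p != C]}.
  move=> p /Pin[h1 h2 h3]; have [_ ? ?] := orient_distinct h1; have [_ ? _] := orient_distinct h2.
  by split; rewrite eq_sym.
have inh (Q : pred pl) : (3 * size red <= size [seq p <- P | Q p])%N -> exists2 p, p \in P & Q p.
  move=> h; have : has Q P by rewrite has_count -size_filter; apply: leq_trans h; rewrite muln_gt0.
  by case/hasP => p pP Qp; exists p.
have [p1 p1P /andP[p1A p1B]] := inh _ zAB.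
have [p2 p2P /andP[p2B p2C]] := inh _ zBC.
have [p3 p3P /andP[p3C p3A]] := inh _ zCA.
have sumF x : FA x + FB x + FC x = 0 by exact: fan_sum.
have [s1 [ps1 sm1 esc1]] := fan_path AX BX CX hA hB ABC kA0 kB0 kC0 uP Pb Ab Bb Pn
  (fun p pP => let: And3 h _ _ := Pin p pP in h) sA sB red0
  (ex_intro2 _ _ p3 p3P p3A) (ex_intro2 _ _ p2 p2P p2B) zAB.
have Pn2 : {in P, forall p, [/\ p != B, p != C & p != A]} by move=> p /Pn[].
have [s2 [ps2 sm2 esc2]] := fan_path BX CX AX hB hC BCA kB0 kC0 kA0 uP Pb Bb Cb Pn2
  (fun p pP => let: And3 _ h _ := Pin p pP in h) sB sC red0
  (ex_intro2 _ _ p1 p1P p1B) (ex_intro2 _ _ p3 p3P p3C) zBC.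
have Pn3 : {in P, forall p, [/\ p != C, p != A & p != B]} by move=> p /Pn[].
have [s3 [ps3 sm3 esc3]] := fan_path CX AX BX hC hA CAB kC0 kA0 kB0 uP Pb Cb Ab Pn3
  (fun p pP => let: And3 _ _ h := Pin p pP in h) sC sA red0
  (ex_intro2 _ _ p2 p2P p2C) (ex_intro2 _ _ p1 p1P p1A) zCA.
move: esc1 esc2 esc3; rewrite -/FA -/FB -/FC => esc1 esc2 esc3.
have m1 x : x \in s1 -> [/\ x \in blue, x \notin [:: A; B; C], 0 < FA x & FB x < 0].
  by rewrite (perm_mem ps1) mem_filter => /andP[/andP[-> /andP[]]].
have m2 x : x \in s2 -> [/\ x \in blue, x \notin [:: A; B; C], 0 < FB x & FC x < 0].
  rewrite (perm_mem ps2) mem_filter => /andP[/andP[n /andP[]]] h1 h2 xb; split=> //.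
  by move: n; rewrite !inE; do 3!case: (_ == _).
have m3 x : x \in s3 -> [/\ x \in blue, x \notin [:: A; B; C], 0 < FC x & FA x < 0].
  rewrite (perm_mem ps3) mem_filter => /andP[/andP[n /andP[]]] h1 h2 xb; split=> //.
  by move: n; rewrite !inE; do 3!case: (_ == _).
have nABC : 0 < - orient A B C by rewrite oppr_gt0.
have nBCA : 0 < - orient B C A by rewrite oppr_gt0.
have nCAB : 0 < - orient C A B by rewrite oppr_gt0.
have [FAA FBB FCC] : [/\ FA A = 0, FB B = 0 & FC C = 0] by rewrite /FA /FB /FC !fan_at.
have [FAB FBC FCA] : [/\ 0 < FA B, 0 < FB C & 0 < FC A].
  by rewrite /FA /FB /FC !fan_next !mulr_gt0.
have [FAC FBA FCB] : [/\ FA C < 0, FB A < 0 & FC B < 0].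
  by rewrite /FA /FB /FC !fan_prev !pmulr_rlt0.
exists A, (s1 ++ B :: s2 ++ C :: s3).
have -> : edges A (rcons (s1 ++ B :: s2 ++ C :: s3) A) =
    edges A (rcons s1 B) ++ (edges B (rcons s2 C) ++ edges C (rcons s3 A)).
  by rewrite -cat_rcons rcons_cat edges_cat -cat_rcons rcons_cat edges_cat.
set E1 := edges A _; set E2 := edges B _; set E3 := edges C _.
have ends1 (Q : pl -> Prop) : Q A -> Q B -> (forall x, x \in s1 -> Q x) -> ends_in Q E1.
  by move=> qA qB qs; apply: edges_ends => // x; rewrite mem_rcons inE => /predU1P[->|/qs].
have ends2 (Q : pl -> Prop) : Q B -> Q C -> (forall x, x \in s2 -> Q x) -> ends_in Q E2.
  by move=> qA qB qs; apply: edges_ends => // x; rewrite mem_rcons inE => /predU1P[->|/qs].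
have ends3 (Q : pl -> Prop) : Q C -> Q A -> (forall x, x \in s3 -> Q x) -> ends_in Q E3.
  by move=> qA qB qs; apply: edges_ends => // x; rewrite mem_rcons inE => /predU1P[->|/qs].
have sEA x : FA x = side (fan_dir A B C kB kC) A x by exact: fanE.
have sEB x : FB x = side (fan_dir B C A kC kA) B x by exact: fanE.
have sEC x : FC x = side (fan_dir C A B kA kB) C x by exact: fanE.
(* Two consecutive paths are separated by the cevian through their common vertex. *)
have n21 : noncross E2 E1.
  apply: (noncross_sep gpX BX (u := fan_dir B C A kC kA) (q := B)); last by rewrite side0.
    by apply: ends2 => [||x /m2[/blueX ? _ hx _]]; rewrite -sEB ?FBB; split=> //; exact: ltW.
  by apply: ends1 => [||x /m1[/blueX ? _ _]]; rewrite -?sEB; split=> //; [left|right|left].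
have n32 : noncross E3 E2.
  apply: (noncross_sep gpX CX (u := fan_dir C A B kA kB) (q := C)); last by rewrite side0.
    by apply: ends3 => [||x /m3[/blueX ? _ hx _]]; rewrite -sEC ?FCC; split=> //; exact: ltW.
  by apply: ends2 => [||x /m2[/blueX ? _ _]]; rewrite -?sEC; split=> //; [left|right|left].
have n13 : noncross E1 E3.
  apply: (noncross_sep gpX AX (u := fan_dir A B C kB kC) (q := A)); last by rewrite side0.
    by apply: ends1 => [||x /m1[/blueX ? _ hx _]]; rewrite -sEA ?FAA; split=> //; exact: ltW.
  by apply: ends3 => [||x /m3[/blueX ? _ _]]; rewrite -?sEA; split=> //; [left|right|left].
have nsym (e1 e2 : seq (pl * pl)) : noncross e1 e2 -> noncross e2 e1.
  by move=> n e e' eE e'E x xe xe'; have [] := n _ _ e'E eE x xe' xe.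
have allX : ends_in (fun z => z \in X) (E1 ++ (E2 ++ E3)).
  move=> e; rewrite !mem_cat => /or3P[h|h|h].
  - by apply: (ends1 (fun z => z \in X)) h => // x /m1[/blueX].
  - by apply: (ends2 (fun z => z \in X)) h => // x /m2[/blueX].
  - by apply: (ends3 (fun z => z \in X)) h => // x /m3[/blueX].
have sector x : x \in X -> x \notin [:: A; B; C] ->
    [|| (0 < FA x) && (FB x < 0), (0 < FB x) && (FC x < 0) | (0 < FC x) && (FA x < 0)].
  move=> xX; rewrite !inE !negb_or => /and3P[xA xB xC]; have [/(_ xA) + /(_ xB) + /(_ xC)] := gen _ xX.
  have := sumF x; move: (FA x) (FB x) (FC x) => a b c; clear.
  by case: (ltgtP a 0); case: (ltgtP b 0); case: (ltgtP c 0) => // *; exfalso; lra.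
have below_on q u Es x (f : pl -> R) : (forall y, f y = side u q y) ->
   ends_in (fun z => f z <= 0) Es -> on_edge Es x -> f x <= 0.
  move=> fE hE [e eE [t t01 ->]]; have [h1 h2] := hE _ eE; rewrite fE side_mix -oppr_ge0 opprD -!mulrN.
  by apply: sum_pos_side => //; rewrite -fE oppr_ge0.
split.
- apply: uniq_perm => //.
    have u1 : uniq s1 by rewrite (perm_uniq ps1) filter_uniq.
    have u2 : uniq s2 by rewrite (perm_uniq ps2) filter_uniq.
    have u3 : uniq s3 by rewrite (perm_uniq ps3) filter_uniq.
    have v1 x : x \in [:: A; B; C] -> x \notin s1 by apply: contraTN => /m1[].
    have v2 x : x \in [:: A; B; C] -> x \notin s2 by apply: contraTN => /m2[].
    have v3 x : x \in [:: A; B; C] -> x \notin s3 by apply: contraTN => /m3[].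
    have [iA [iB iC]] : A \in [:: A; B; C] /\ B \in [:: A; B; C] /\ C \in [:: A; B; C].
      by rewrite !inE !eqxx !orbT.
    have d12 x : x \in s2 -> x \notin s1.
      by case/m2 => _ _ h _; apply/negP => /m1[_ _ _]; rewrite ltNge (ltW h).
    have d13 x : x \in s3 -> x \notin s1.
      by case/m3 => _ _ _ h; apply/negP => /m1[_ _ + _]; rewrite ltNge (ltW h).
    have d23 x : x \in s3 -> x \notin s2.
      by case/m3 => _ _ h _; apply/negP => /m2[_ _ _]; rewrite ltNge (ltW h).
    have h3 : uniq (C :: s3) by rewrite cons_uniq u3 v3.
    have h2 : uniq (B :: s2 ++ C :: s3).
      rewrite cons_uniq mem_cat inE !negb_or v2 // BC v3 // cat_uniq u2 h3 !andTb andbT.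
      by apply/hasPn => x; rewrite inE => /predU1P[->|/d23 //]; exact: v2.
    rewrite cons_uniq mem_cat inE mem_cat inE !negb_or v1 // AB v2 // AC v3 //.
    rewrite cat_uniq u1 h2 !andTb andbT; apply/hasPn => x.
    by rewrite inE mem_cat inE => /or4P[/eqP->|/d12|/eqP->|/d13] //; exact: v1.
  move=> x; rewrite inE mem_cat inE mem_cat inE.
  rewrite (perm_mem ps1) (perm_mem ps2) (perm_mem ps3) !mem_filter !inE.
  case: (eqVneq x A) => [->|xA] /=; first by rewrite Ab.
  case: (eqVneq x B) => [->|xB] /=; first by rewrite Bb ?orbT.
  case: (eqVneq x C) => [->|xC] /=; first by rewrite Cb ?orbT.
  rewrite -!andb_orl; case xb: (x \in blue); rewrite ?andbF // !andbT.
  by apply: sector; [exact: blueX | rewrite !inE !negb_or xA xB].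
- apply: simple_cat => //; first by apply: simple_cat => //; exact: nsym.
  by move=> e e' eE; rewrite mem_cat => /orP[]; [apply: (nsym _ _ n21)|apply: n13].
move=> r rr; have rX := redX rr.
have rn : r \notin [:: A; B; C].
  by apply/negP; rewrite !inE => /or3P[]/eqP h; have := disj rr; rewrite h ?Ab ?Bb ?Cb.
case/or3P: (sector _ rX rn) => /andP[h1 h2].
- apply: (esc1 _ allX) => // x xA xB /on_edge_cat[//|/on_edge_cat[h|h]]; exfalso.
    have : 0 <= FB x; last by rewrite leNgt xB.
    rewrite sEB; apply: on_edge_side h; apply: ends2 => [||y /m2[_ _ hy _]]; rewrite -sEB ?FBB //; exact: ltW.
  have : FA x <= 0; last by rewrite leNgt xA.
  apply: (below_on _ _ _ _ _ sEA _ h); apply: ends3 => [||y /m3[_ _ _ hy]]; rewrite ?FAA //; exact: ltW.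
- apply: (esc2 _ allX) => // x xA xB /on_edge_cat[h|/on_edge_cat[//|h]]; exfalso.
    have : FB x <= 0; last by rewrite leNgt xA.
    apply: (below_on _ _ _ _ _ sEB _ h); apply: ends1 => [||y /m1[_ _ _ hy]]; rewrite ?FBB //; exact: ltW.
  have : 0 <= FC x; last by rewrite leNgt xB.
  rewrite sEC; apply: on_edge_side h; apply: ends3 => [||y /m3[_ _ hy _]]; rewrite -sEC ?FCC //; exact: ltW.
- apply: (esc3 _ allX) => // x xA xB /on_edge_cat[h|/on_edge_cat[h|//]]; exfalso.
    have : 0 <= FA x; last by rewrite leNgt xB.
    rewrite sEA; apply: on_edge_side h; apply: ends1 => [||y /m1[_ _ hy _]]; rewrite -sEA ?FAA //; exact: ltW.
  have : FC x <= 0; last by rewrite leNgt xA.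
  apply: (below_on _ _ _ _ _ sEC _ h); apply: ends2 => [||y /m2[_ _ _ hy]]; rewrite ?FCC //; exact: ltW.
Qed.
End Fan.

Lemma size_filter_sub (T : eqType) (a b : pred T) (s : seq T) :
  {in s, forall i, a i -> b i} -> (size [seq i <- s | a i] <= size [seq i <- s | b i])%N.
Proof.
move=> ab; rewrite !size_filter (eq_in_count (a2 := predI a b)).
  by apply: sub_count => i /andP[].
by move=> i /ab /=; case: (a i) => // ->.
Qed.

(** Used to choose weights for which no point of X other than the vertex lies on a cevian. *)
Lemma avoid_seq (R : realFieldType) (L : seq R) (lo hi : R) : lo < hi ->
  exists w, [/\ lo < w, w < hi & w \notin L].
Proof.
elim: L lo => [|a L IH] lo lh; first by exists ((lo + hi) / 2); split=> //; lra.
have [w [lw wh wL]] := IH _ lh.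
have [wa|wa] := eqVneq w a; last by exists w; rewrite inE negb_or wa.
have [w' [lw' w'h w'L]] := IH _ wh.
exists w'; rewrite inE negb_or w'L andbT; split=> //; first exact: lt_trans lw'.
by rewrite -wa gt_eqF.
Qed.

(** The two values are consecutive in increasing order, so any number in the gap splits s into n
    points and the rest. *)
Lemma threshold (R : realFieldType) (T : eqType) (val : T -> R) (s : seq T) n :
  uniq s -> {in s &, injective val} -> (0 < n < size s)%N ->
  exists i j, [/\ i \in s, val i < val j,
    (n <= size [seq x <- s | (val x <= val i)%R])%N &
    (size s - n <= size [seq x <- s | (val j <= val x)%R])%N].
Proof.
move=> us inj /andP[n0 ns]; pose le := relpre val <=%R.
have tle : transitive le by move=> ? ? ?; exact: le_trans.
have ps : perm_eq (sort le s) s by rewrite perm_sort.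
have ss : pairwise le (sort le s).
  by rewrite -sorted_pairwise //; apply: sort_sorted => ? ?; exact: le_total.
have E := cat_take_drop n (sort le s).
have s1 : size (take n (sort le s)) = n by rewrite size_take (perm_size ps) ns.
have s2 : size (drop n (sort le s)) = (size s - n)%N by rewrite size_drop (perm_size ps).
move: E s1 s2; case/lastP: (take _ _) => [|l i]; first by move=> _ E; rewrite -E in n0.
case: (drop _ _) => [|j d]; first by move=> _ _ /esym/eqP; rewrite subn_eq0 leqNgt ns.
move=> E s1 s2; have p : perm_eq (rcons l i ++ j :: d) s by rewrite E.
have u : uniq (rcons l i ++ j :: d) by rewrite (perm_uniq p).
move: ss; rewrite -E pairwise_cat pairwise_rcons /=.
case/and4P => /allrelP across /andP[/allP li _] /allP dj _.
have il : i \in rcons l i by rewrite mem_rcons mem_head.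
have jd : j \in j :: d by rewrite mem_head.
have iS : i \in s by rewrite -(perm_mem p) mem_cat il.
have jS : j \in s by rewrite -(perm_mem p) mem_cat jd orbT.
exists i, j; split=> //.
- rewrite lt_neqAle (across _ _ il jd : val i <= val j) andbT; apply: contraTneq u => /(inj _ _ iS jS) ij.
  rewrite cat_uniq negb_and -has_sym; apply/orP; right; rewrite negb_and; apply/orP; left.
  by rewrite negbK; apply/hasP; exists i; rewrite // ij.
- rewrite size_filter -(permP p) count_cat -s1; apply: leq_trans (leq_addr _ _).
  have : all (fun x => val x <= val i) (rcons l i).
    by apply/allP => x; rewrite mem_rcons inE => /predU1P[->//|/li].
  by rewrite all_count => /eqP ->.
- rewrite size_filter -(permP p) count_cat -s2; apply: leq_trans (leq_addl _ _).
  have : all (fun x => val j <= val x) (j :: d).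
    by apply/allP => x; rewrite inE => /predU1P[->//|/dj].
  by rewrite all_count => /eqP ->.
Qed.

Section Triangle.
Variable R : realFieldType.
Notation pl := (plane R).
Implicit Types (p q r u v w x y z A B C : pl) (t k : R) (E : seq (pl * pl)).
Variable X : seq pl.
Hypothesis gpX : gp (mem X).
Variables blue red : seq pl.
Hypotheses (blueX : {subset blue <= X}) (redX : {subset red <= X}).
Hypotheses (ublue : uniq blue) (ured : uniq red) (disj : {in red, forall r, r \notin blue}).

(** Equal ratios of these barycentric coordinates put p and q on one line through C. *)
Lemma ratio_inj A B C p q : p \in X -> q \in X -> C \in X -> p != C -> q != C ->
  orient A B C != 0 -> orient C A p < 0 -> orient C A q < 0 ->
  orient B C p / orient C A p = orient B C q / orient C A q -> p = q.
Proof.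
move=> pX qX CX pC qC n p0 q0 E; apply/eqP/negPn/negP => pq.
have := gpX CX pX qX; rewrite !(eq_sym C) => /(_ pC pq qC)/eqP[].
apply: (mulfI n); rewrite mulr0.
have -> : orient A B C * orient C p q =
   orient B C p * orient C A q - orient B C q * orient C A p.
  by rewrite /orient /cross /=; ring.
have [np nq] : orient C A p != 0 /\ orient C A q != 0 by rewrite !lt_eqF.
by apply/eqP; rewrite subr_eq0 -eqr_div // E.
Qed.

(** With weight 1 at A, the weight [kB] fixes the cevian at C and leaves at least 6 l points on each
    of its sides. Raising [kC] moves the other two cevians and fills the sector BC from one side,
    the sector CA from the other. Stop just after both have 3 l points: the side that was last to
    get there still has 3 l points beyond its threshold, and these are in the sector AB. *)
Lemma triangle_polygon A B C (P : seq pl) :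
  A \in X -> B \in X -> C \in X ->
  hull_vertex X A -> hull_vertex X B -> hull_vertex X C -> orient A B C < 0 ->
  uniq P -> {subset P <= blue} -> A \in blue -> B \in blue -> C \in blue ->
  {in P, forall p, [/\ orient A B p < 0, orient B C p < 0 & orient C A p < 0]} ->
  same_side red A P -> same_side red B P -> same_side red C P ->
  (0 < size red)%N -> (12 * size red <= size P)%N ->
  excluding_polygon blue red.
Proof.
move=> AX BX CX hA hB hC ABC uP Pb Ab Bb Cb Pin sA sB sC l0 szP.
have PX p : p \in P -> p \in X by move=> /Pb /blueX.
have BCA : orient B C A < 0 by rewrite -orient_rot.
have CAB : orient C A B < 0 by rewrite -orient_rot.
have nABC : orient A B C != 0 by rewrite lt_eqF.
have nBCA : orient B C A != 0 by rewrite lt_eqF.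
have nCAB : orient C A B != 0 by rewrite lt_eqF.
have [AB BC AC] := orient_distinct ABC.
have Pn : {in P, forall p, [/\ p != A, p != B & p != C]}.
  move=> p /Pin[h1 h2 h3]; have [_ ? ?] := orient_distinct h1; have [_ ? _] := orient_distinct h2.
  by split; rewrite eq_sym.
pose l := size red; pose rC p := orient B C p / orient C A p.
have rC0 p : p \in P -> 0 < rC p by case/Pin => _ h1 h2; rewrite /rC -mulrNN -invrN divr_gt0 ?oppr_gt0.
have [||i [j [iP ij zi zj]]] := @threshold R pl rC P (6 * l) uP.
- move=> p q pP qP; have [_ _ pC] := Pn _ pP; have [_ _ qC] := Pn _ qP.
  have [_ _ p0] := Pin _ pP; have [_ _ q0] := Pin _ qP.
  exact: (ratio_inj (PX _ pP) (PX _ qP) CX pC qC nABC).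
- by rewrite muln_gt0 l0 /=; apply: leq_trans szP; rewrite ltn_pmul2r.
have [kB [ikB kBj kBL]] := avoid_seq [seq rC x | x <- X] ij.
have kB0 : 0 < kB by apply: lt_trans ikB; exact: rC0.
pose Pa := [seq p <- P | (rC p < kB)%R]; pose Pb' := [seq p <- P | (kB < rC p)%R].
have szPa : (6 * l <= size Pa)%N.
  by apply: leq_trans zi _; apply: size_filter_sub => p _ h; apply: le_lt_trans ikB.
have szPb : (6 * l <= size Pb')%N.
  apply: leq_trans (_ : size P - 6 * l <= _)%N.
    by rewrite leq_subRL; rewrite -?mulnDl // (leq_trans _ szP) // leq_mul2r orbT.
  by apply: leq_trans zj _; apply: size_filter_sub => p _ h; apply: lt_le_trans h.
pose va p := orient B C p / orient A B p; pose vb p := kB * (orient C A p / orient A B p).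
have l3 : (0 < 3 * l)%N by rewrite muln_gt0.
have l36 m : (6 * l <= m)%N -> (3 * l < m)%N by apply: leq_trans; rewrite ltn_pmul2r.
have l33 m : (6 * l <= m)%N -> (3 * l <= m - 3 * l)%N.
  by move=> h; rewrite leq_subRL ?(ltnW (l36 _ h)) // -mulnDl.
have PaP p : p \in Pa -> p \in P /\ rC p < kB by rewrite mem_filter => /andP[].
have PbP p : p \in Pb' -> p \in P /\ kB < rC p by rewrite mem_filter => /andP[].
have [||ia [ja [iaP ija zia zja]]] := @threshold R pl va Pa (3 * l) (filter_uniq _ uP).
- move=> p q /PaP[pP _] /PaP[qP _] E; have [_ pB _] := Pn _ pP; have [_ qB _] := Pn _ qP.
  have [_ p0 _] := Pin _ pP; have [_ q0 _] := Pin _ qP.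
  apply: (ratio_inj (PX _ pP) (PX _ qP) BX pB qB nCAB p0 q0).
  by move/(congr1 GRing.inv): E; rewrite !invf_div.
- by rewrite l3 l36.
have [||ib [jb [ibP ijb zib zjb]]] := @threshold R pl vb Pb' (3 * l) (filter_uniq _ uP).
- move=> p q /PbP[pP _] /PbP[qP _] /(mulfI (lt0r_neq0 kB0)) E.
  have [pA _ _] := Pn _ pP; have [qA _ _] := Pn _ qP.
  have [p0 _ _] := Pin _ pP; have [q0 _ _] := Pin _ qP.
  exact: (ratio_inj (PX _ pP) (PX _ qP) AX pA qA nBCA p0 q0).
- by rewrite l3 l36.
pose L2 := [seq vb x | x <- X] ++ [seq va x | x <- X].
have [kC [akC bkC kCL kCj]] : exists kC, [/\ va ia < kC, vb ib < kC, kC \notin L2 &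
    kC < va ja \/ kC < vb jb].
  have [h|/ltW h] := lerP (vb ib) (va ia).
    have [k [k1 k2 k3]] := avoid_seq L2 ija.
    by exists k; split=> //; [apply: le_lt_trans k1 | left].
  have [k [k1 k2 k3]] := avoid_seq L2 ijb.
  by exists k; split=> //; [apply: le_lt_trans k1 | right].
have va0 p : p \in P -> 0 < va p by case/Pin => h1 h2 _; rewrite /va -mulrNN -invrN divr_gt0 ?oppr_gt0.
have kC0 : 0 < kC by apply: lt_trans akC; apply: va0; have [] := PaP _ iaP.
have kBL' x : x \in X -> kB != rC x by move=> xX; apply: contraNneq kBL => ->; exact: map_f.
have kCa x : x \in X -> kC != va x.
  by move=> xX; apply: contraNneq kCL => ->; rewrite mem_cat map_f ?orbT.
have kCb x : x \in X -> kC != vb x.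
  by move=> xX; apply: contraNneq kCL => ->; rewrite mem_cat map_f.
have cmpC p k : p \in P -> ((rC p < k) = (k * orient C A p < orient B C p)) *
    ((k < rC p) = (orient B C p < k * orient C A p)).
  by case/Pin => _ _ h; rewrite /rC ltr_ndivrMr // ltr_ndivlMr.
have cmpa p k : p \in P -> ((va p < k) = (k * orient A B p < orient B C p)) *
    ((k < va p) = (orient B C p < k * orient A B p)).
  by case/Pin => h _ _; rewrite /va ltr_ndivrMr // ltr_ndivlMr.
have cmpb p k : p \in P -> ((vb p < k) = (k * orient A B p < kB * orient C A p)) *
    ((k < vb p) = (kB * orient C A p < k * orient A B p)).
  by case/Pin => h _ _; rewrite /vb mulrA ltr_ndivrMr // ltr_ndivlMr.
have sub (Q : pred pl) (P' : seq pl) (a : pred pl) (b : pred pl) :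
    P' = [seq p <- P | a p] -> {in P, forall p, a p -> b p -> Q p} ->
    (size [seq p <- P' | b p] <= size [seq p <- P | Q p])%N.
  move=> -> h; rewrite -filter_predI; apply: size_filter_sub => p pP /andP[bp ap].
  exact: h.
apply: (@fan_polygon _ _ gpX _ _ _ _ _ _ _ A B C 1 kB kC P) => //.
- move=> x xX; rewrite /fan !mul1r; split=> xV.
  + have [->|xB] := eqVneq x B.
      by rewrite orient_deg mulr0 sub0r -mulrN gt_eqF // mulr_gt0 ?oppr_gt0.
    rewrite subr_eq0; apply: contraNneq (kCb _ xX) => h.
    by apply/eqP; rewrite /vb mulrA -h mulfK // gpX // eq_sym.
  + have [->|xA] := eqVneq x A; first by rewrite orient_deg mulr0 subr0 lt_eqF.
    rewrite subr_eq0; apply: contraNneq (kCa _ xX) => h.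
    by apply/eqP; rewrite /va h mulfK // gpX // eq_sym.
  + have [->|xA] := eqVneq x A.
      by rewrite orient_deg mulr0 sub0r gt_eqF // oppr_gt0.
    rewrite subr_eq0; apply: contraNneq (kBL' _ xX) => h.
    by apply/eqP; rewrite /rC -h mulfK // gpX // eq_sym.
- apply: leq_trans (_ : 3 * l <= _)%N => //.
  case: kCj => kCj.
    apply: leq_trans (l33 _ szPa) _; apply: leq_trans zja _; apply: sub erefl _ => p pP.
    rewrite /fan !mul1r cmpC // => h1 /(lt_le_trans kCj); rewrite cmpa // => h2.
    by rewrite subr_gt0 subr_lt0 h2 (lt_trans h1 h2).
  apply: leq_trans (l33 _ szPb) _; apply: leq_trans zjb _; apply: sub erefl _ => p pP.
  rewrite /fan !mul1r cmpC // => h1 /(lt_le_trans kCj); rewrite cmpb // => h2.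
  by rewrite subr_gt0 subr_lt0 h2 (lt_trans h1 h2).
- apply: leq_trans (_ : 3 * l <= _)%N => //; apply: leq_trans zia _; apply: sub erefl _ => p pP.
  rewrite /fan !mul1r cmpC // => h1 h2; have := le_lt_trans h2 akC; rewrite cmpa // => h3.
  by rewrite subr_gt0 subr_lt0 h3 h1.
- apply: leq_trans (_ : 3 * l <= _)%N => //; apply: leq_trans zib _; apply: sub erefl _ => p pP.
  rewrite /fan !mul1r cmpC // => h1 h2; have := le_lt_trans h2 bkC; rewrite cmpb // => h3.
  by rewrite subr_gt0 subr_lt0 h3 h1.
Qed.
End Triangle.

(** * Choice of the configuration *)

Lemma seq_first (T : eqType) (e : rel T) (s : seq T) : total e -> transitive e ->
  s != [::] -> exists2 x, x \in s & {in s, forall y, e x y}.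
Proof.
move=> te tre s0; have ps : perm_eq (sort e s) s by rewrite perm_sort.
have ss := sort_sorted te s; case: (sort e s) ps ss => [|x s'] ps.
  by move: s0; rewrite -size_eq0 -(perm_size ps).
move=> /= px; exists x; first by rewrite -(perm_mem ps) mem_head.
move=> y; rewrite -(perm_mem ps) inE => /predU1P[->|ys]; first by have := te x x; rewrite orbb.
exact: (allP (order_path_min tre px)).
Qed.

Lemma count_lt_witness (T : eqType) (a b : pred T) (s : seq T) :
  (count a s < count b s)%N -> exists2 x, x \in s & b x && ~~ a x.
Proof.
move=> h; apply/hasP; apply: contraLR h; rewrite -leqNgt => /hasPn h.
rewrite (eq_in_count (a2 := predI b a)); first by apply: sub_count => x /andP[].
by move=> x /h /=; case: (b x) => //=; rewrite negbK => ->.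
Qed.

(* [12 l] points for the triangle, after two pigeonholes over the [l + 1]
   positions among the red points seen from the two hull vertices. *)
Definition fan_bound l := ((l + 1) * ((l + 1) * (12 * l)))%N.
(** The factor l + 1 is the pigeonhole at v. Of the points left, fewer than [fan_bound l] have the
    lowest rank and fewer than that the highest, unless a triangle works; 6 l + 1 remain for
    [two_sided_polygon]. *)
Definition interior_bound l := ((l + 1) * (2 * fan_bound l + (6 * l + 1)))%N.

Section Selection.
Variable R : realFieldType.
Notation pl := (plane R).
Implicit Types (p q r u v w x y z A B C : pl) (t k : R) (E : seq (pl * pl)).
Variable X : seq pl.
Hypothesis gpX : gp (mem X).
Variables blue red : seq pl.
Hypotheses (uX : uniq X) (blueX : {subset blue <= X}) (redX : {subset red <= X}).
Hypotheses (ublue : uniq blue) (ured : uniq red) (disj : {in red, forall r, r \notin blue}).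
Hypothesis hull_blue : forall z, z \in X -> hull_vertex X z -> z \in blue.

(** At a point of X farthest from the origin, the tangent to the circle about the origin supports X
    strictly. *)
Lemma farthest_hull_vertex : X != [::] -> exists2 v, v \in X & hull_vertex X v.
Proof.
move=> X0; pose e x y := dot y y <= dot x x.
have [||v vX hv] := @seq_first _ e X _ _ X0.
- by move=> x y; exact: le_total.
- by move=> y x z h1 h2; exact: le_trans h2 h1.
exists v => //; exists (- v.2, v.1) => y yX yv.
have -> : side (- v.2, v.1) v y =
    ((dot v v - dot y y) + dot (vec v y) (vec v y)) / 2.
  by rewrite /side /cross /dot /vec /=; field.
rewrite divr_gt0 // ltr_wpDl //; first by rewrite subr_ge0; exact: hv.
rewrite /dot; have [h1|h1] := eqVneq y.1 v.1; last first.
  by apply: ltr_pwDl; rewrite -expr2 ?exprn_even_gt0 //= ?subr_eq0 // sqr_ge0.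
have h2 : y.2 != v.2.
  by apply: contraNneq yv => h2; rewrite [y]surjective_pairing h1 h2 -surjective_pairing.
by apply: ltr_wpDl; rewrite -expr2 ?exprn_even_gt0 //= ?subr_eq0 // sqr_ge0.
Qed.

Lemma same_side_pigeonhole V (Q : seq pl) N : V \in X -> hull_vertex X V -> uniq Q ->
  {subset Q <= X} -> V \notin Q -> ((size red + 1) * N <= size Q)%N ->
  exists P, [/\ uniq P, {subset P <= Q}, (N <= size P)%N & same_side red V P].
Proof.
move=> VX hV uQ QX VQ sz; pose key q := count (below V ^~ q) red.
have [||j Nj] := @pigeonhole pl key (size red + 1) N Q _ sz.
- by move=> q _; rewrite addn1 ltnS count_size.
- by rewrite addn1.
exists [seq q <- Q | key q == j]; split=> //; first by rewrite filter_uniq.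
  by move=> q; rewrite mem_filter => /andP[].
have Vred : V \notin red by apply/negP => /disj; rewrite hull_blue.
move=> p q; rewrite !mem_filter => /andP[/eqP kp pQ] /andP[/eqP kq qQ].
apply: (below_count_eq gpX VX hV) => //; try exact: QX.
- by apply: contraNneq VQ => <-.
- by apply: contraNneq VQ => <-.
by rewrite -/(key p) kp -kq.
Qed.

Section Base.
Variable v : pl.
Hypotheses (vX : v \in X) (hv : hull_vertex X v).
Variable Q : seq pl.
Hypotheses (uQ : uniq Q) (Qblue : {subset Q <= blue}) (Qhull : {in Q, forall q, ~ hull_vertex X q}).
Hypothesis Qside : same_side red v Q.
Hypothesis red0 : (0 < size red)%N.

Let H := [seq z <- X | has (next_on_hull X z) X && (z != v)].

Let QX q : q \in Q -> q \in X. Proof. by move=> /Qblue /blueX. Qed.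
Let Qv q : q \in Q -> q != v.
Proof. by move=> qQ; apply/eqP => qv; case: (Qhull qQ); rewrite qv. Qed.
Let vb : v \in blue. Proof. exact: hull_blue. Qed.

Let X1 : (1 < size X)%N.
Proof.
case E : red => [|r s]; first by move: red0; rewrite E.
have rr : r \in red by rewrite E mem_head.
have nvr : v != r by apply: contraNneq (disj rr) => <-.
rewrite -[2%N]/(size [:: v; r]); apply: uniq_leq_size; first by rewrite /= inE nvr.
by move=> x; rewrite !inE => /orP[]/eqP-> //; exact: redX.
Qed.

Let HP z : z \in H <-> [/\ z \in X, hull_vertex X z & z != v].
Proof.
rewrite mem_filter; split=> [/andP[/andP[/hasP[w _ /hull_edge_vertices[]]]]|[zX hz zv]] //.
rewrite zX zv !andbT; have [w nw] := hull_vertex_next gpX zX X1 uX hz.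
by have [_ wX _ _] := next_on_hullP nw; apply/hasP; exists w.
Qed.

Let HX : {subset H <= X}. Proof. by move=> z /HP[]. Qed.
Let vH : v \notin H. Proof. by apply/negP => /HP[_ _]; rewrite eqxx. Qed.
Let HQ z q : z \in H -> q \in Q -> z != q.
Proof. by move=> /HP[_ hz _] qQ; apply/eqP => zq; case: (Qhull qQ); rewrite -zq. Qed.
(** Points of equal rank are seen from v between the same two consecutive hull vertices. *)
Let rank q := count (below v ^~ q) H.
Let tot := below_total gpX vX.

Lemma constant_rank_polygon (P : seq pl) : uniq P -> {subset P <= Q} ->
  {in P &, forall p q, rank p = rank q} -> (fan_bound (size red) <= size P)%N ->
  excluding_polygon blue red.
Proof.
move=> uP PQ rP szP.
have [q0 q0P] : exists q0, q0 \in P.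
  case: P szP {uP PQ rP} => [|q P] sz; last by exists q; rewrite mem_head.
  by move: sz; rewrite leqn0 /fan_bound !muln_eq0 !addn1 /= -leqn0 leqNgt red0.
have q0Q := PQ _ q0P; have q0X := QX q0Q; have q0v := Qv q0Q.
have [m nm] := hull_vertex_next gpX vX X1 uX hv.
have [_ mX mv hm] := next_on_hullP nm.
have mH : m \in H by apply/HP; split=> //; exact: (hull_edge_vertices nm).2.
have [|||A] := hull_vertex_last gpX (L := [seq z <- H | below v z q0]) hv vX.
- by move=> z; rewrite mem_filter => /andP[_ /HX].
- by rewrite mem_filter (negPf vH) andbF.
- rewrite -size_eq0 size_filter -lt0n -has_count; apply/hasP; exists m => //.
  by apply: hm => //; rewrite eq_sym HQ.
rewrite mem_filter => /andP[Aq0 AH] lastA.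
have [AX hA Av] := (HP A).1 AH.
have [B nB] := hull_vertex_next gpX AX X1 uX hA.
have [_ BX BA hB] := next_on_hullP nB.
have Bv : B != v.
  apply: contraTneq (Aq0) => Bv; rewrite below_asym // /below -orient_rot -Bv.
  by apply: hB; rewrite // ?Bv // eq_sym HQ.
have AB := next_below vX nB Av Bv.
have BH : B \in H by apply/HP; split=> //; exact: (hull_edge_vertices nB).2.
have nBq0 : ~~ below v B q0.
  apply/negP => Bq0; have := lastA B; rewrite mem_filter Bq0 BH => /(_ isT BA).
  by rewrite -/(below v B A) below_asym.
have eqb q z : q \in P -> z \in H -> below v z q = below v z q0.
  move=> qP; have qQ := PQ _ qP.
  by apply: (below_count_eq gpX vX hv HX vH (QX qQ) q0X (Qv qQ) q0v); exact: rP.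
have Pin q : q \in P -> [/\ orient A B q < 0, orient B v q < 0 & orient v A q < 0].
  move=> qP; have qQ := PQ _ qP; split.
  - by apply: hB; [exact: QX | rewrite eq_sym HQ | rewrite eq_sym HQ].
  - rewrite orient_rot -/(below v q B).
    have := tot BX (QX qQ) Bv (Qv qQ) (HQ BH qQ).
    by rewrite eqb // (negPf nBq0).
  - by rewrite -/(below v A q) eqb.
have nVP V : V \in H -> V \notin P.
  by move=> VH; apply/negP => /PQ /(HQ VH); rewrite eqxx.
have [P1 [uP1 P1P szP1 sA]] := same_side_pigeonhole AX hA uP (fun q h => QX (PQ _ h)) (nVP _ AH) szP.
have [P2 [uP2 P21 szP2 sB]] := same_side_pigeonhole BX (hull_edge_vertices nB).2 uP1
  (fun q h => QX (PQ _ (P1P _ h))) (contraNN (P1P B) (nVP _ BH)) szP1.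
have P2P q : q \in P2 -> q \in P by move=> /P21 /P1P.
apply: (triangle_polygon gpX blueX redX ublue ured disj AX BX vX hA
  (hull_edge_vertices nB).2 hv _ uP2) => //.
- by apply: hB; rewrite // eq_sym.
- by move=> q /P2P /PQ /Qblue.
- by apply: hull_blue.
- by apply: hull_blue; last exact: (hull_edge_vertices nB).2.
- by move=> q /P2P /Pin.
- by move=> p q /P21 ? /P21; exact: sA.
- by move=> p q /P2P /PQ ? /P2P /PQ; exact: Qside.
Qed.

Lemma rank_lt_witness p q : (rank p < rank q)%N -> exists2 z, z \in H & below v z q && ~~ below v z p.
Proof. exact: count_lt_witness. Qed.

(** Points of lowest and highest rank are set aside so that a hull vertex [z1] separates [q1] from
    all middle points, and [z2] separates these from [q2]. As no red point is seen between points of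
    Q, one below [q1] is below [z1], and any other is above [q2], hence above [z2]. *)
Lemma many_interior_polygon :
  (2 * fan_bound (size red) + (6 * size red + 1) <= size Q)%N -> excluding_polygon blue red.
Proof.
move=> szQ; have Q0 : Q != [::].
  by rewrite -size_eq0 -lt0n; apply: leq_trans szQ; rewrite addn1 addnS.
have [||q1 q1Q min1] := @seq_first _ (relpre rank leq) Q _ _ Q0.
- by move=> x y; exact: leq_total.
- by move=> y x z; exact: leq_trans.
have [||q2 q2Q max2] := @seq_first _ (fun x y => rank y <= rank x)%N Q _ _ Q0.
- by move=> x y; exact: leq_total.
- by move=> y x z h1 h2; exact: leq_trans h2 h1.
pose Q1 := [seq q <- Q | rank q == rank q1]; pose Q2 := [seq q <- Q | rank q == rank q2].
pose Qm := [seq q <- Q | (rank q != rank q1) && (rank q != rank q2)].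
have [h|lt1] := leqP (fan_bound (size red)) (size Q1).
  apply: (@constant_rank_polygon Q1) => //; first by rewrite filter_uniq.
    by move=> q; rewrite mem_filter => /andP[].
  by move=> p q; rewrite !mem_filter => /andP[/eqP-> _] /andP[/eqP-> _].
have [h|lt2] := leqP (fan_bound (size red)) (size Q2).
  apply: (@constant_rank_polygon Q2) => //; first by rewrite filter_uniq.
    by move=> q; rewrite mem_filter => /andP[].
  by move=> p q; rewrite !mem_filter => /andP[/eqP-> _] /andP[/eqP-> _].
have szm : (6 * size red + 1 <= size Qm)%N.
  have : (size Q <= size Q1 + size Q2 + size Qm)%N.
    rewrite !size_filter -addnA -(count_predC (fun q => rank q == rank q1)) leq_add2l.
    rewrite -[X in (X <= _)%N]size_filter -(count_predC (fun q => rank q == rank q2)).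
    rewrite !count_filter; apply: leq_add; apply: sub_count => q /= /andP[h1 h2] //.
    by rewrite h1 h2.
  have arith (f m q a b c : nat) : (2 * f + m <= q -> a < f -> b < f -> q <= a + b + c -> m <= c)%N.
    by clear; lia.
  exact: arith szQ lt1 lt2.
have QmP q : q \in Qm -> [/\ q \in Q, (rank q1 < rank q)%N & (rank q < rank q2)%N].
  rewrite mem_filter => /andP[/andP[n1 n2] qQ]; split=> //.
    by rewrite ltn_neqAle eq_sym n1; exact: min1.
  by rewrite ltn_neqAle n2; exact: max2.
have [qm qmP] : exists q, q \in Qm.
  by case: (Qm) szm => [|q s]; [rewrite addn1 | exists q; rewrite mem_head].
have [qmQ r1m rm2] := QmP _ qmP.
have [|||z1] := hull_vertex_first gpX (L := [seq z <- H | ~~ below v z q1]) hv vX.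
- by move=> z; rewrite mem_filter => /andP[_ /HX].
- by rewrite mem_filter (negPf vH) andbF.
- have [z zH /andP[_ h]] := rank_lt_witness r1m.
  by rewrite -size_eq0 size_filter -lt0n -has_count; apply/hasP; exists z.
rewrite mem_filter => /andP[nz1 z1H] first1.
have [|||z2] := hull_vertex_last gpX (L := [seq z <- H | below v z q2]) hv vX.
- by move=> z; rewrite mem_filter => /andP[_ /HX].
- by rewrite mem_filter (negPf vH) andbF.
- have [z zH /andP[h _]] := rank_lt_witness rm2.
  by rewrite -size_eq0 size_filter -lt0n -has_count; apply/hasP; exists z.
rewrite mem_filter => /andP[b2 z2H] last2.
have [z1X hz1 z1v] := (HP z1).1 z1H; have [z2X hz2 z2v] := (HP z2).1 z2H.
have trans := below_trans gpX vX hv.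
have b1 : below v q1 z1.
  by have := tot z1X (QX q1Q) z1v (Qv q1Q) (HQ z1H q1Q); rewrite (negPf nz1).
have bm q : q \in Qm -> below v z1 q /\ below v q z2.
  case/QmP => qQ h1 h2; split.
    have [z zH /andP[zq nz]] := rank_lt_witness h1.
    have [<-//|zz1] := eqVneq z z1.
    have : below v z1 z by apply: first1 => //; rewrite mem_filter nz.
    by move=> h; exact: (trans _ _ _ (HX zH) z1X (QX qQ) h zq).
  have [z zH /andP[zq2 nz]] := rank_lt_witness h2.
  have qz : below v q z.
    have [zv _ _] := below_neq zq2.
    by have := tot (HX zH) (QX qQ) zv (Qv qQ) (HQ zH qQ); rewrite (negPf nz).
  have [<-//|zz2] := eqVneq z z2.
  have : below v z z2 by apply: last2 => //; rewrite mem_filter zq2.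
  by move=> h; exact: (trans _ _ _ (HX zH) (QX qQ) z2X qz h).
have [bm1 bm2] := bm _ qmP.
have b12 := trans _ _ _ (QX qmQ) z1X z2X bm1 bm2.
have QmQ q : q \in Qm -> q \in Q by case/QmP.
apply: (two_sided_polygon gpX uX blueX redX ublue ured disj hull_blue vX hv z1X hz1 z2X hz2 b12
   (Q := Qm)) => //.
- by rewrite filter_uniq.
- by move=> q /QmQ /Qblue.
- by move=> q /QmQ; exact: Qhull.
move=> r rr; have rX := redX rr.
have rv : r != v by apply: contraTneq vb => <-; exact: disj.
have rQ q : q \in Q -> r != q by move=> qQ; apply: contraTneq (Qblue qQ) => <-; exact: disj.
case rq1 : (below v r q1); [left|right].
  split; first exact: (trans _ _ _ (QX q1Q) rX z1X rq1 b1).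
  by move=> q /QmQ qQ; rewrite (Qside qQ q1Q rr).
have above q : q \in Q -> below v q r.
  move=> qQ; have := tot rX (QX qQ) rv (Qv qQ) (rQ _ qQ).
  by rewrite (Qside qQ q1Q rr) rq1.
split; first exact: (trans _ _ _ (QX q2Q) z2X rX b2 (above _ q2Q)).
by move=> q /QmQ; exact: above.
Qed.
End Base.

Lemma excluding_polygon_exists (P : seq pl) : (0 < size red)%N -> uniq P -> {subset P <= blue} ->
  {in P, forall p, ~ hull_vertex X p} -> (interior_bound (size red) <= size P)%N ->
  excluding_polygon blue red.
Proof.
move=> red0 uP Pb Ph szP.
have [|v vX hv] := farthest_hull_vertex.
  by case: (X) redX red0 => // h; case: (red) h => // r s /(_ r); rewrite mem_head => /(_ isT).
have vP : v \notin P by apply/negP => /Ph.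
have [Q [uQ QP szQ sQ]] := same_side_pigeonhole vX hv uP (fun p h => blueX (Pb _ h)) vP szP.
apply: (many_interior_polygon vX hv uQ _ _ sQ red0 szQ).
  by move=> q /QP /Pb.
by move=> q /QP /Ph.
Qed.
End Selection.

(** * Unbounded components and the final translation *)

Local Open Scope classical_set_scope.

Section Topology.
Variable R : realType.
Notation pl := (plane R).
Implicit Types (p q x d : pl) (t : R).

Lemma segmentE p q x : segment p q x <-> on_seg p q x.
Proof.
split=> [[t _ <-]|[t /andP[t0 t1] ->]].
  (* The library's convex combination puts the parameter on the first point, [mix] on the second. *)
  exists (1 - t%:num).
    by rewrite subr_ge0 lerBlDr lerDl ge0 le1.
  by rewrite /conv /= /mix; case: (p); case: (q) => *; congr pair => /=; rewrite /GRing.scale /= /unstable.onem; ring.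
have h1 : 0 <= 1 - t by rewrite subr_ge0.
have h2 : 1 - t <= 1 by rewrite gerBl.
exists (Itv01 h1 h2) => //=; rewrite /conv /= /mix.
by case: (p); case: (q) => *; congr pair => /=; rewrite /GRing.scale /= /unstable.onem; ring.
Qed.

Lemma ray_continuous x d : continuous (fun t : R => ray x t d : pl).
Proof.
have aff (a b : R) : continuous (fun t : R => a + t * b).
  move=> t; apply: cvgD; first exact: cvg_cst.
  by apply: cvgM; [exact: cvg_id|exact: cvg_cst].
move=> t; exact: (cvg_pair (aff _ _ t) (aff _ _ t)).
Qed.

Lemma ray_image_connected x d (I : set R) : is_interval I ->
  connected ((fun t => ray x t d) @` I).
Proof.
move=> II; apply: connected_continuous_connected; first exact/connected_intervalP.
apply: continuous_subspaceT; exact: ray_continuous.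
Qed.

Lemma bounded_set_bound (A : set pl) : bounded_set A ->
  exists M, forall x, A x -> `|x.1| <= M /\ `|x.2| <= M.
Proof.
case=> M [Mr HM]; exists (M + 1) => x Ax.
have := HM (M + 1) (ltr_pwDr ltr01 (lexx M)) x Ax.
by rewrite /= /Num.norm /= ge_max => /andP[].
Qed.

Lemma ray_coord_unbounded (a b M : R) : b != 0 ->
  exists2 t, 0 <= t & M < `|a + t * b|.
Proof.
move=> b0; have nb : 0 < `|b| by rewrite normr_gt0.
exists ((`|M| + `|a| + 1) / `|b|).
  by rewrite divr_ge0 // !addr_ge0.
set t := _ / _; have t0 : 0 <= t by rewrite divr_ge0 // !addr_ge0.
have Et : `|t * b| = `|M| + `|a| + 1.
  by rewrite normrM (ger0_norm t0) divfK // gt_eqF.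
have := lerB_normD (t * b) a; rewrite Et (addrC (t * b)).
have := ler_norm M; lra.
Qed.

(** The escape path itself is the connected set; its last ray makes it unbounded. *)
Lemma escapes_connected (G : pl -> Prop) x : escapes G x ->
  exists A : set pl, [/\ connected A, A x, A `<=` ~` [set p | G p] & ~ bounded_set A].
Proof.
elim=> {x}[x d dn0 av|x d t t0 av _ [A [cA Ax nA uA]]].
  exists ((fun t => ray x t d) @` [set t | 0 <= t]); split.
  - apply: ray_image_connected => s1 s2 /= h1 h2 s /andP[h _]; exact: le_trans h.
  - by exists 0; rewrite /= ?lexx // ray0.
  - by move=> _ [t /= t0 <-]; apply: av.
  move=> /bounded_set_bound[M HM].
  have : (d.1 != 0) || (d.2 != 0).
    move: dn0; apply: contraNT; rewrite negb_or !negbK => /andP[/eqP d1 /eqP d2].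
    by apply/eqP; case: (d) d1 d2 => ? ? /= -> ->.
  case/orP => d0.
    have [t t0] := ray_coord_unbounded x.1 M d0; rewrite ltNge => /negP; apply.
    by have [] := HM (ray x t d) (ex_intro2 _ _ t t0 erefl).
  have [t t0] := ray_coord_unbounded x.2 M d0; rewrite ltNge => /negP; apply.
  by have [] := HM (ray x t d) (ex_intro2 _ _ t t0 erefl).
exists ((fun s => ray x s d) @` [set s | 0 <= s <= t] `|` A); split.
- apply: connectedU => //.
    by exists (ray x t d); split => //; exists t; rewrite /= ?t0 ?lexx.
  apply: ray_image_connected => s1 s2 /= /andP[h1 h2] /andP[h3 h4] s /andP[h5 h6].
  by rewrite (le_trans h1 h5) (le_trans h6 h4).
- by left; exists 0; rewrite /= ?lexx ?t0 // ray0.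
- by move=> y [[s /= s0 <-]|/nA //]; apply: av.
move=> bA; apply: uA; move: bA => [M [Mr HM]]; exists M; split=> // M' MM' y Ay.
by apply: (HM _ MM'); right.
Qed.

Lemma escapes_exterior s x : escapes (polygon_boundary s) x -> exterior s x.
Proof.
move=> ex; split; first exact: escapes_notin ex.
have [A [cA Ax nA uA]] := escapes_connected ex.
move=> [M [Mr HM]]; apply: uA; exists M; split=> // M' MM' y Ay.
by apply: (HM _ MM'); apply: connected_component_max Ay.
Qed.
End Topology.

(** The closing point [y0] is kept apart from the start y so that the induction goes through. *)
Lemma edges_next (R : realFieldType) (y0 y : R * R) (s : seq (R * R)) (e : (R * R) * (R * R)) :
  uniq (y :: s) ->
  (e \in edges y (rcons s y0)) = (e.1 \in y :: s) && (e.2 == next_at e.1 y0 y s).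
Proof.
case: e => e1 e2; elim: s y => [|y' s IH] y us.
  by rewrite /= !inE xpair_eqE; case: (eqVneq e1 y).
have /andP[ys us'] := us.
rewrite [edges _ _]/= in_cons IH //= [e1 \in y :: _]in_cons xpair_eqE.
case: (eqVneq e1 y) => [->|] //=.
by rewrite (negPf ys) andFb orbF.
Qed.

Lemma escapes_sub (R : realFieldType) (G G' : R * R -> Prop) x :
  (forall y, G' y -> G y) -> escapes G x -> escapes G' x.
Proof.
move=> GG; elim=> {x}[x d d0 av|x d t t0 av _ IH].
  by apply: (escapes_ray d0) => t t0 /GG; exact: av.
by apply: escapes_step t0 _ IH => s s0 /GG; exact: av.
Qed.

Section Conversion.
Context {R : realType}.
Implicit Types (p q r x y : plane R).

Lemma boundary_edges (x0 : plane R) s x : uniq (x0 :: s) ->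
  polygon_boundary (x0 :: s) x <-> on_edge (edges x0 (rcons s x0)) x.
Proof.
move=> us; split=> [[v /= vs /segmentE vx]|[e]].
  by exists (v, next (x0 :: s) v) => //; rewrite edges_next // vs /=.
rewrite edges_next // => /andP[es /eqP e2] ex; exists e.1 => //=.
by apply/segmentE; rewrite -e2.
Qed.

Lemma simple_edges_polygon (x0 : plane R) s : (3 <= size (x0 :: s))%N -> uniq (x0 :: s) ->
  simple (edges x0 (rcons s x0)) -> simple_polygon (x0 :: s).
Proof.
move=> sz us sm; split=> // v w vs ws vw x [/segmentE xv /segmentE xw].
have ev z : z \in x0 :: s -> (z, next (x0 :: s) z) \in edges x0 (rcons s x0).
  by move=> zs; rewrite edges_next // zs /=.
have ne : (v, next (x0 :: s) v) != (w, next (x0 :: s) w).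
  by apply: contraNneq vw => -[->].
by have [h1 h2] := sm _ _ (ev _ vs) (ev _ ws) ne x xv xw; split.
Qed.

Lemma general_position_gp (S : {fset plane R}) : general_position S -> gp (mem S).
Proof.
move=> gS a b c aS bS cS ab bc ac; apply/eqP => o0.
apply: (gS a b c) => //; first by rewrite /= !inE negb_or ab ac bc.
exists (b.2 - a.2), (a.1 - b.1), ((b.2 - a.2) * a.1 + (a.1 - b.1) * a.2); split.
  apply: contraNneq ab => -[/eqP h2 /eqP h1]; rewrite !subr_eq0 in h1 h2.
  by rewrite [a]surjective_pairing [b]surjective_pairing (eqP h1) (eqP h2).
move=> x /= [[->|->]|->] //; first by ring.
by apply/eqP; rewrite -subr_eq0 -[X in _ == X]oppr0 -o0 /orient /cross /=; apply/eqP; ring.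
Qed.

(** The open half plane of a strict support, together with v, is convex and contains X, hence its
    hull; v is extreme already in this larger set. *)
Lemma hull_vertex_extreme (X : seq (plane R)) v : v \in X -> hull_vertex X v ->
  extreme_points (convex_hull [set x | x \in X]) v.
Proof.
move=> vX [u hu]; pose K : set (plane R) := [set x | x = v \/ 0 < side u v x].
have convE (x y : plane R) (t : {i01 R}) :
    conv t (x : convex_lmodType (plane R)) y = mix t%:num y x.
  rewrite /conv /= /mix; case: (x); case: (y) => *.
  by congr pair => /=; rewrite /GRing.scale /= /unstable.onem; ring.
have convK : convex_set (K : set (convex_lmodType (plane R))).
  move=> x y t /set_mem Kx /set_mem Ky; apply/mem_set; rewrite convE /K /= side_mix.
  have t0 : 0 <= t%:num by []. have t1 : t%:num <= 1 by [].
  have [->|tn0] := eqVneq t%:num 0.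
    rewrite subr0 mul1r mul0r addr0; case: Ky => [->|]; [left|by right].
    by rewrite /mix; case: (v) => *; congr pair => /=; ring.
  have [->|tn1] := eqVneq t%:num 1.
    rewrite subrr mul1r mul0r add0r; case: Kx => [->|]; [left|by right].
    by rewrite /mix; case: (v) => *; congr pair => /=; ring.
  have p0 : 0 < t%:num by rewrite lt0r tn0.
  have p1 : 0 < 1 - t%:num by rewrite subr_gt0 lt_neqAle tn1.
  case: Kx Ky => [->|hx] [->|hy]; rewrite ?side0.
  - by left; rewrite /mix; case: (v) => *; congr pair => /=; ring.
  - by right; rewrite mulr0 addr0 mulr_gt0.
  - by right; rewrite mulr0 add0r mulr_gt0.
  - by right; rewrite addr_gt0 // mulr_gt0.
have hullK : convex_hull [set x | x \in X] `<=` K.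
  move=> x; apply; split=> // y /= yX; have [->|yv] := eqVneq y v; first by left.
  by right; apply: hu.
split; first by move=> A [_]; apply.
move=> p q t /hullK Kp /hullK Kq /andP[t0 t1]; rewrite convE => E.
have : side u v v = 0 by rewrite side0.
rewrite [X in side u v X]E side_mix.
case: Kp Kq => [->|hp] [->|hq] //; rewrite ?side0 => /eqP.
- by rewrite mulr0 addr0 gt_eqF // mulr_gt0 // subr_gt0.
- by rewrite mulr0 add0r gt_eqF // mulr_gt0.
- by rewrite gt_eqF // addr_gt0 // mulr_gt0 // subr_gt0.
Qed.
End Conversion.

Lemma interior_bound_gt2 l : (1 <= l)%N -> (3 <= interior_bound l)%N.
Proof. by move=> l1; rewrite /interior_bound /fan_bound; nia. Qed.

(** The constant 206 is [interior_bound 1], so the bound is attained at l = 1. *)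
Lemma interior_bound_le l : (1 <= l)%N -> (interior_bound l <= 206 * l ^ 4)%N.
Proof.
move=> l1; rewrite /interior_bound /fan_bound; case: l l1 => // l _.
by rewrite !expnS expn0; nia.
Qed.

Theorem theorem1 (R : realType) :
  exists K0 : nat -> nat,
    (forall l : nat, (1 <= l)%N -> (1 <= K0 l)%N) /\
    (fun l : nat => (K0 l)%:R : R^o) =O_\oo (fun l : nat => l%:R ^+ 4 : R^o) /\
    forall (blue red hull_vertices : {fset plane R}) (l n k : nat),
      [disjoint blue & red]%fset ->
      general_position (blue `|` red)%fset ->
      #|` red| = l -> (1 <= l)%N ->
      [set` hull_vertices] =
        extreme_points (convex_hull [set` (blue `|` red)%fset]) ->
      (hull_vertices `<=` blue)%fset ->
      #|` hull_vertices| = n ->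
      k = (#|` blue| - n)%N ->
      (K0 l <= k)%N ->
      exists s : seq (plane R), polygonization s blue /\ excludes s red.
Proof.
exists interior_bound; split.
  by move=> l /interior_bound_gt2; apply: leq_trans.
split.
  apply/eqOP; exists 206; split=> // M M206; exists 1%N => // l /= l1.
  rewrite !ger0_norm ?exprn_ge0 //.
  apply: (@le_trans _ _ (206 * l%:R ^+ 4)); last by rewrite ler_wpM2r ?exprn_ge0 // ltW.
  by rewrite -natrX -natrM ler_nat interior_bound_le.
move=> blue red hv l n k disj gpS cr l1 hvE hvb cn -> szK.
pose X : seq (plane R) := enum_fset (blue `|` red)%fset.
have gpX : gp (mem X) by exact: general_position_gp gpS.
have bX : {subset (blue : seq _) <= X} by move=> x xb; rewrite /X in_fsetU xb.
have rX : {subset (red : seq _) <= X} by move=> x xr; rewrite /X in_fsetU xr orbT.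
have dis : {in (red : seq _), forall r, r \notin (blue : seq _)}.
  by move=> r rr; apply/negP => rb; move/fdisjointP: disj => /(_ _ rb); rewrite rr.
(* Used twice: the hull vertices of X are blue, and the k blue points outside [hv] are not hull
   vertices. *)
have ext z : z \in X -> hull_vertex X z -> z \in hv.
  move=> zX hz; suff : [set` hv] z by [].
  by rewrite hvE; exact: hull_vertex_extreme.
pose P : seq (plane R) := enum_fset (blue `\` hv)%fset.
have szP : (interior_bound (size red) <= size P)%N.
  rewrite -[size red]/(#|` red|) cr -[size P]/(#|` (blue `\` hv)%fset|) cardfsD.
  by move/fsetIidPr: hvb => ->; rewrite cn.
have [||||||x0 [s [ps sm esc]]] := @excluding_polygon_exists R X gpX blue red (fset_uniq _)
   bX rX (fset_uniq _) (fset_uniq _) dis _ P.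
- by move=> z zX hz; move/fsubsetP: hvb; apply; exact: ext.
- by rewrite -[size red]/(#|` red|) cr.
- exact: fset_uniq.
- by move=> p; rewrite in_fsetD => /andP[].
- move=> p; rewrite in_fsetD => /andP[pn pb] hp; move/negP: pn; apply.
  by apply: ext => //; exact: bX.
- exact: szP.
have us : uniq (x0 :: s) by rewrite (perm_uniq ps) fset_uniq.
exists (x0 :: s); split.
  split; last by move=> x; rewrite (perm_mem ps).
  apply: simple_edges_polygon => //; rewrite (perm_size ps).
  apply: leq_trans (interior_bound_gt2 l1) _; apply: leq_trans szK _.
  exact: leq_subr.
move=> r /= rr; apply: escapes_exterior; apply: escapes_sub (esc _ rr) => y.
by move/boundary_edges; apply.
Qed.
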